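(* For every $p\in(2,+\infty]$ there is a positive constant $c(p)$, depending only on $p$, such that the following holds. Let $X\colon\overline B\to\mathbb R^4$ be a conformally parametrized immersion with area element $W$ and normal bundle of curvature $S_N$, let $N=(N_1,N_2)$ be a normal Coulomb frame of $X$, and let $\Psi:=T_{1,1}^2-i\,T_{1,2}^2\colon B\to\mathbb C$ be its complex-valued torsion. Then $$|\Psi(w)|\le c(p)\,\|S_NW\|_{L^p(B)}\quad\text{for all } w\in B.$$
   Context: $B=\{(u,v)\in\mathbb R^2: u^2+v^2<1\}$; $u^1=u$, $u^2=v$. Immersions satisfy $X\in C^{k,\beta}(\overline B,\mathbb R^{4})$ for some integer $k\ge3$ and $\beta\in(0,1)$, with $\mathrm{rank}\,DX=2$ on $\overline B$. Conformally parametrized: $X_u\cdot X_u=X_v\cdot X_v=W$, $X_u\cdot X_v=0$ on $\overline B$. A normal frame is a pair $N=(N_1,N_2)$ of maps in $C^{k-1,\beta}(\overline B,\mathbb R^4)$ with $N_\sigma\cdot N_\vartheta=\delta_{\sigma\vartheta}$, $N_\sigma\cdot X_{u^i}=0$, $\det(X_u,X_v,N_1,N_2)>0$. Torsion coefficients: $T_{\sigma,i}^\vartheta=N_{\sigma,u^i}\cdot N_\vartheta$. Curvature of the normal bundle: $S_N=\frac1W\big(\partial_vT_{1,1}^2-\partial_uT_{1,2}^2\big)$ (independent of the normal frame). Total torsion (in conformal parameters): $\mathcal T(N)=2\iint_B\{(T_{1,1}^2)^2+(T_{1,2}^2)^2\}\,du\,dv$. $N$ is a normal Coulomb frame if it is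 critical for $\mathcal T$ with respect to variations $\widetilde N_1=\cos\varphi\,N_1+\sin\varphi\,N_2$, $\widetilde N_2=-\sin\varphi\,N_1+\cos\varphi\,N_2$ (i.e. for every smooth $\psi$ on $\overline B$, taking $\varphi=\varepsilon\psi$, the derivative of $\mathcal T(\widetilde N)$ at $\varepsilon=0$ vanishes). *)

(* Defs.v *)
From HB Require Import structures.
From mathcomp Require Import all_boot all_order all_algebra.
From mathcomp Require Import all_classical all_reals all_analysis.
From mathcomp Require Import complex.

Set Implicit Arguments.
Unset Strict Implicit.
Unset Printing Implicit Defensive.

Import Order.TTheory GRing.Theory Num.Theory.
Import numFieldNormedType.Exports.

Local Open Scope classical_set_scope.
Local Open Scope ring_scope.

Section Disc.
Variable R : realType.
Implicit Types (w : R * R) (f : R * R -> R).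

Definition disc : set (R * R) := [set w | w.1 ^+ 2 + w.2 ^+ 2 < 1].

Definition cdisc : set (R * R) := [set w | w.1 ^+ 2 + w.2 ^+ 2 <= 1].

Definition edist (w z : R * R) : R :=
  Num.sqrt ((w.1 - z.1) ^+ 2 + (w.2 - z.2) ^+ 2).

(* The coordinates u^1 = u and u^2 = v carry the indices 0 and 1 : 'I_2. *)
Definition axis (i : 'I_2) : R * R := if i == 0 then (1, 0) else (0, 1).

(* The partial derivative on the closed disc: the interior derivative, extended
   to the boundary by its limit from inside.  The filter is not punctured, so
   that where the limit exists at a point of [disc] it is the derivative. *)
Definition pd (i : 'I_2) f w : R :=
  lim ('D_(axis i) f z @[z --> within disc (nbhs w)]).

(* All partial derivatives of f of order at most k exist in the open disc and
   extend to the closed disc: continuously for orders less than k, with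
   property P (which is to entail continuity) for order k. *)
Fixpoint regular (P : (R * R -> R) -> Prop) (k : nat) f : Prop :=
  if k is k'.+1 then
    {within cdisc, continuous f} /\
    forall i : 'I_2,
      (forall w, disc w -> derivable f w (axis i)) /\
      exists2 g, (forall w, disc w -> g w = 'D_(axis i) f w) &
                 regular P k' g
  else P f.

Definition hoelder_cont (b : R) f : Prop :=
  exists C : R, forall w z, cdisc w -> cdisc z ->
    `|f w - f z| <= C * edist w z `^ b.

Definition Ckb (k : nat) (b : R) f : Prop := regular (hoelder_cont b) k f.

Definition Csmooth f : Prop :=
  forall k, regular (fun g => {within cdisc, continuous g}) k f.

Definition lebesgue2 :=
  (@lebesgue_measure R \x @lebesgue_measure R)%E.

End Disc.

Section Surface.
Variable R : realType.
Implicit Types (X Y : R * R -> 'rV[R]_4) (N : 'I_2 -> R * R -> 'rV[R]_4).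
Implicit Types (w : R * R).

Definition dot (x y : 'rV[R]_4) : R := \sum_j x 0 j * y 0 j.

Definition vCkb (k : nat) (b : R) Y : Prop :=
  forall j, Ckb k b (fun w => Y w 0 j).

Definition vpd (i : 'I_2) Y w : 'rV[R]_4 :=
  \row_j pd i (fun z => Y z 0 j) w.

Definition immersion (k : nat) (b : R) X : Prop :=
  vCkb k b X /\
  forall w, cdisc w -> \rank (\matrix_(i < 2) vpd i X w) = 2%N.

Definition conformal X : Prop :=
  forall w, cdisc w ->
    dot (vpd 0 X w) (vpd 0 X w) = dot (vpd 1 X w) (vpd 1 X w) /\
    dot (vpd 0 X w) (vpd 1 X w) = 0.

(* For conformal X the area element W is the common value X_u . X_u = X_v . X_v. *)
Definition area_elt X w : R := dot (vpd 0 X w) (vpd 0 X w).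

(* N_1 and N_2 are N 0 and N 1. *)
Definition normal_frame (k : nat) (b : R) X N : Prop :=
  (forall s, vCkb k.-1 b (N s)) /\
  forall w, cdisc w ->
    [/\ forall s t, dot (N s w) (N t w) = (s == t)%:R,
        forall s i, dot (N s w) (vpd i X w) = 0 &
        0 < \det (\matrix_(i < 4)
              nth 0 [:: vpd 0 X w; vpd 1 X w; N 0 w; N 1 w] i)].

(* torsion N s i t = T_{s,i}^t *)
Definition torsion N (s i t : 'I_2) w : R := dot (vpd i (N s) w) (N t w).

Definition curvature X N w : R :=
  (area_elt X w)^-1 * (pd 1 (torsion N 0 0 1) w - pd 0 (torsion N 0 1 1) w).

Definition total_torsion N : R :=
  2 * \int[@lebesgue2 R]_(w in @disc R)
        (torsion N 0 0 1 w ^+ 2 + torsion N 0 1 1 w ^+ 2).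

Definition rotate N (phi : R * R -> R) (s : 'I_2) w : 'rV[R]_4 :=
  if s == 0 then cos (phi w) *: N 0 w + sin (phi w) *: N 1 w
  else - sin (phi w) *: N 0 w + cos (phi w) *: N 1 w.

Definition coulomb_frame (k : nat) (b : R) X N : Prop :=
  normal_frame k b X N /\
  forall psi, Csmooth psi ->
    is_derive (0 : R) (1 : R)
      (fun e : R => total_torsion (rotate N (fun w => e * psi w))) (0 : R).

Definition complex_torsion N w : R[i] :=
  (torsion N 0 0 1 w -i* torsion N 0 1 1 w)%C.

Definition Lp_disc (p : \bar R) (f : R * R -> R) : \bar R :=
  'N[@lebesgue2 R]_p [EFin \o (f \_ (@disc R))]%E.

End Surface.

(* Main.v *)
Require Import Defs.
From HB Require Import structures.
From mathcomp Require Import all_boot all_order all_algebra.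
From mathcomp Require Import all_classical all_reals all_analysis.
From mathcomp Require Import complex.
From mathcomp Require Import measurable_realfun ess_sup_inf ring lra.

Set Implicit Arguments.
Unset Strict Implicit.
Unset Printing Implicit Defensive.

Import Order.TTheory GRing.Theory Num.Theory.
Import numFieldNormedType.Exports.

Local Open Scope classical_set_scope.
Local Open Scope ring_scope.

(* In conformal parameters the torsion (V0, V1) of a Coulomb frame is, weakly,
   divergence free and tangential to the unit circle, and its curl is S_N W.
   For w0 = a + i b in the disc and c = V0(w0) + i V1(w0), the function
     h(w) = c / (w - w0) + conj c * w / (1 - conj w0 * w) = psi - i chi
   is meromorphic with a single pole at w0 and real on the circle, since there
   |w - w0| = |1 - conj w0 * w|.  Regularizing its denominators by h^2 gives
   smooth rational test functions, chi still vanishing on the circle.  Testing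
   the divergence with psi and integrating the curl by parts against chi yields
     int 2 Re (Psi dbar h) = - int S_N W chi.
   As the regularization tends to 0 the left side concentrates at w0 and bounds
   |Psi(w0)|^2 from above up to a constant, while |chi| <= 2 |c| / |w - w0| in
   the disc.  Hoelder's inequality concludes, because 1 / |w - w0| is in L^q for
   q < 2, with a norm bounded independently of w0: since
   |w - w0|^2 >= |x - a| |y - b| this reduces to one-dimensional integrals. *)

(** * Topology and measurability in the plane, and extension from the closed disc *)

Section Plane.
Variable R : realType.
Implicit Types (w z : R * R) (f g : R * R -> R).

(** The sigma-algebra on [R * R] is the product one, so an open set has to be reached by a countable
    union of boxes: the boxes with rational end points contained in [U] cover it. *)
Lemma open_measurable_plane (U : set (R * R)) : open U -> measurable U.
Proof.
move=> oU.
pose box (q : (rat * rat) * (rat * rat)) : set (R * R) :=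
  `]ratr q.1.1, ratr q.1.2[%classic `*` `]ratr q.2.1, ratr q.2.2[%classic.
pose F q := if `[< box q `<=` U >] then box q else set0.
have -> : U = \bigcup_q F q.
  apply/seteqP; split => [[x y] Uxy|w [q _]]; last first.
    by rewrite /F; case: asboolP => // qU /qU.
  have [e /= e0 eU] : exists2 e : R, 0 < e & ball (x, y) e `<=` U.
    have /nbhs_ballP[e e0 eU] : nbhs (x, y) U by exact: open_nbhs_nbhs.
    by exists e.
  have [q1] := @rat_in_itvoo R (x - e) x ltac:(lra).
  have [q2] := @rat_in_itvoo R x (x + e) ltac:(lra).
  have [q3] := @rat_in_itvoo R (y - e) y ltac:(lra).
  have [q4] := @rat_in_itvoo R y (y + e) ltac:(lra).
  rewrite !in_itv /= => /andP[a1 a2] /andP[b1 b2] /andP[c1 c2] /andP[d1 d2].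
  exists ((q1, q2), (q3, q4)) => //; rewrite /F; case: asboolP => [_|[]].
    by split; rewrite /= in_itv /=; apply/andP.
  move=> [x' y'] [] /=; rewrite !in_itv /= => /andP[f1 f2] /andP[g1 g2].
  by apply: eU; split => /=; rewrite /ball /= ltr_norml; lra.
apply: countable_bigcupT_measurable => [|q]; first exact: countableP.
by rewrite /F; case: ifP => // _; exact: measurableX.
Qed.

Lemma continuous_measurable_plane f : continuous f -> measurable_fun setT f.
Proof.
move=> /continuousP cf; apply: (measurability _ (RGenOpens.measurableE R)).
move=> _ [_ [a [b ->] <-]]; rewrite setTI; apply: open_measurable_plane.
exact/cf/interval_open.
Qed.

Lemma continuous_fst : continuous (fun w => w.1).
Proof. by move=> w; exact: cvg_fst. Qed.

Lemma continuous_snd : continuous (fun w => w.2).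
Proof. by move=> w; exact: cvg_snd. Qed.

Let rho w := w.1 ^+ 2 + w.2 ^+ 2.

Lemma continuous_rho : continuous rho.
Proof.
move=> w; rewrite /rho; under eq_fun do rewrite !expr2.
by apply: cvgD; apply: cvgM; do ?[exact: cvg_fst|exact: cvg_snd].
Qed.

Lemma open_disc : open (@disc R).
Proof.
rewrite (_ : @disc R = rho @^-1` [set x | x < 1])//.
apply: open_comp; last exact: open_lt.
by move=> w _; exact: continuous_rho.
Qed.

Lemma measurable_disc : measurable (@disc R).
Proof. by apply: open_measurable_plane; exact: open_disc. Qed.

Lemma disc_cdisc : @disc R `<=` @cdisc R.
Proof. by move=> w; rewrite /disc /cdisc /= => /ltW. Qed.

Lemma cdisc_box w : cdisc w -> (-1 <= w.1 <= 1) /\ (-1 <= w.2 <= 1).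
Proof.
by case: w => x y; rewrite /cdisc /= => h; split; apply/andP; split; nra.
Qed.

Lemma compact_box : compact (`[-1, 1]%classic `*` `[-1, 1]%classic : set (R * R)).
Proof. by apply: compact_setX; exact: segment_compact. Qed.

Lemma compact_cdisc : compact (@cdisc R).
Proof.
apply: (subclosed_compact _ compact_box).
  rewrite (_ : @cdisc R = rho @^-1` [set x | x <= 1])//.
  apply: preimage_closed; last exact: closed_le.
  by move=> w _; exact: continuous_rho.
by move=> w /cdisc_box[h1 h2]; split; rewrite /= in_itv.
Qed.

Lemma continuous_bounded_cdisc f : continuous f ->
  exists2 M : R, 0 <= M & forall w, cdisc w -> `|f w| <= M.
Proof.
move=> cf.
have cg : {within @cdisc R, continuous (fun w => `|f w|)}.
  by apply: continuous_subspaceT => w; apply: cvg_norm; exact: cf.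
have n0 : @cdisc R !=set0 by exists (0, 0); rewrite /cdisc /=; lra.
have [w _ h] := compact_EVT_max n0 compact_cdisc cg.
exists `|f w|; first by rewrite normr_ge0.
by move=> z Dz; apply: h; rewrite inE.
Qed.

Lemma continuous_pair f g : continuous f -> continuous g ->
  continuous (fun w => (f w, g w)).
Proof.
by move=> cf cg w; exact: (@cvg_pair _ _ _ _ (nbhs (f w)) (nbhs (g w)) _ _ _
  f g (cf w) (cg w)).
Qed.

(* Inversion in the unit circle outside of the disc. *)
Let retr w : R * R := let m := Num.max 1 (rho w) in (w.1 / m, w.2 / m).

Let max_gt0 w : 0 < Num.max 1 (rho w).
Proof. by rewrite lt_max ltr01. Qed.

Let continuous_retr : continuous retr.
Proof.
have cm : continuous (fun w => (Num.max 1 (rho w))^-1).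
  move=> w; apply: cvgV; first by rewrite gt_eqF.
  apply: (@continuous_max _ _ (cst 1) rho); first exact: cvg_cst.
  exact: continuous_rho.
apply: continuous_pair => w; (apply: cvgM; last exact: cm).
  exact: cvg_fst.
exact: cvg_snd.
Qed.

Let cdisc_retr w : cdisc (retr w).
Proof.
rewrite /cdisc /= !expr_div_n -mulrDl ler_pdivrMr ?exprn_gt0// mul1r.
rewrite -/(rho w) expr2 (le_trans (_ : _ <= Num.max 1 (rho w)))//.
  by rewrite le_max lexx orbT.
by rewrite ler_peMr ?(ltW (max_gt0 _))// le_max lexx.
Qed.

Let retr_id w : cdisc w -> retr w = w.
Proof.
rewrite /cdisc /= => h; rewrite /retr.
have -> : Num.max 1 (rho w) = 1 by apply/max_idPl.
by rewrite !divr1; case: (w).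
Qed.

(** Composition with [retr], a continuous retraction of the plane onto the closed disc, gives the
    extension. Later arguments can thus use functions continuous, hence measurable, on the whole
    plane instead of the subspace topology. *)
Lemma within_cdisc_ext f : {within @cdisc R, continuous f} ->
  exists2 F, continuous F & forall w, cdisc w -> F w = f w.
Proof.
move=> cf; exists (f \o retr); last by move=> w Dw /=; rewrite retr_id.
apply/continuousP => A oA; rewrite comp_preimage.
have /open_subspaceP[V oV VD] := (continuousP _).1 cf _ oA.
suff -> : retr @^-1` (f @^-1` A) = retr @^-1` V.
  by exact: (continuousP _).1 continuous_retr _ oV.
apply/seteqP; split => w /= h.
  by have [] : (V `&` @cdisc R) (retr w) by rewrite VD.
by have [] : (f @^-1` A `&` @cdisc R) (retr w) by rewrite -VD.
Qed.

End Plane.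

(** * Calculus rules for directional derivatives *)

Section DirectionalDerivative.
Variables (R : realType) (V : normedModType R).
Implicit Types (f g : V -> R) (w v : V).

(** Both sides have the same difference quotient. This transfers the one-variable rules, such as the
    chain rule, to directional derivatives. *)
Lemma is_derive_line f w v df :
  is_derive w v f df <-> is_derive (0 : R) (1 : R) (fun h : R => f (h *: v + w)) df.
Proof.
have E : 'D_v f w = 'D_1 (fun h : R => f (h *: v + w)) 0.
  rewrite /derive; set g1 := fun h => h^-1 *: _; set g2 := fun h => h^-1 *: _.
  suff -> : g1 = g2 by [].
  by rewrite funeqE /g1 /g2 => h /=; rewrite addr0 scale0r add0r [_%:A]mulr1.
split=> -[h1 h2].
  by split; [exact: (derivable1P f w v).1 h1|rewrite -E].
by split; [exact: (derivable1P f w v).2 h1|rewrite E].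
Qed.

Lemma is_derive_affine f w v (t df : R) :
  is_derive (t *: v + w) v f df ->
  is_derive t (1 : R) (fun h : R => f (h *: v + w)) df.
Proof.
move=> [h1 h2]; split.
  apply/(derivable1P _ _ _); move/(derivable1P _ _ _): h1.
  by under eq_fun do rewrite addrA -scalerDl -[X in (X + _) *: _]mulr1.
rewrite -h2 /derive; set g1 := fun h => h^-1 *: _; set g2 := fun h => h^-1 *: _.
suff -> : g1 = g2 by [].
by rewrite funeqE /g1 /g2 => h /=; rewrite scalerDl [_%:A]mulr1 addrA.
Qed.

Lemma is_derive_comp1 f (phi : R -> R) w v df dphi :
  is_derive w v f df -> is_derive (f w) (1 : R) phi dphi ->
  is_derive w v (fun z => phi (f z)) (dphi * df).
Proof.
move=> /is_derive_line hf hphi; apply/is_derive_line.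
apply: (@is_derive1_comp _ phi (fun h : R => f (h *: v + w))) => //.
by rewrite scale0r add0r.
Qed.

Lemma is_deriveDf f g w v df dg : is_derive w v f df -> is_derive w v g dg ->
  is_derive w v (fun z => f z + g z) (df + dg).
Proof. by move=> ? ?; exact: is_deriveD. Qed.

Lemma is_deriveMf f g w v df dg : is_derive w v f df -> is_derive w v g dg ->
  is_derive w v (fun z => f z * g z) (df * g w + f w * dg).
Proof.
move=> ? ?; apply: (@is_derive_eq _ _ _ _ _ _ _ (f w *: dg + g w *: df)).
by rewrite /GRing.scale /= addrC [g w * _]mulrC.
Qed.

Lemma is_deriveVf f w v df : f w != 0 -> is_derive w v f df ->
  is_derive w v (fun z => (f z)^-1) (- df / f w ^+ 2).
Proof.
move=> fw0 [h1 h2]; split; first exact: derivableV.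
by rewrite deriveV// h2 /GRing.scale /= mulNr mulNr mulrC.
Qed.

End DirectionalDerivative.

(** * Rational functions without poles, as a supply of smooth test functions *)

Section RationalFunctions.
Variable R : realType.
Implicit Types (w : R * R) (f g : R * R -> R).

(** A class closed under partial differentiation, so that smoothness of every order follows by
    induction on the order. Denominators must have no zero in the whole plane. The regularized test
    function [test_psi] belongs to it. *)
Inductive rational_fun : (R * R -> R) -> Prop :=
| rational_cst c : rational_fun (fun=> c)
| rational_fst : rational_fun (fun w => w.1)
| rational_snd : rational_fun (fun w => w.2)
| rational_add f g : rational_fun f -> rational_fun g ->
    rational_fun (fun w => f w + g w)
| rational_mul f g : rational_fun f -> rational_fun g ->
    rational_fun (fun w => f w * g w)
| rational_inv f : rational_fun f -> (forall w, f w != 0) ->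
    rational_fun (fun w => (f w)^-1).

Lemma rational_opp f : rational_fun f -> rational_fun (fun w => - f w).
Proof.
move=> rf; under eq_fun do rewrite -mulN1r.
by apply: rational_mul => //; exact: rational_cst.
Qed.

Lemma rational_sub f g : rational_fun f -> rational_fun g ->
  rational_fun (fun w => f w - g w).
Proof. by move=> rf rg; apply: rational_add => //; exact: rational_opp. Qed.

Lemma rational_sqr f : rational_fun f -> rational_fun (fun w => f w ^+ 2).
Proof. by move=> rf; exact: rational_mul. Qed.

Lemma rational_div f g : rational_fun f -> rational_fun g ->
  (forall w, g w != 0) -> rational_fun (fun w => f w / g w).
Proof. by move=> rf rg g0; apply: rational_mul => //; exact: rational_inv. Qed.

Lemma rational_continuous f : rational_fun f -> continuous f.
Proof.
elim=> {f} [c|||f g _ cf _ cg|f g _ cf _ cg|f _ cf f0] w.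
- exact: cvg_cst.
- exact: cvg_fst.
- exact: cvg_snd.
- by apply: cvgD; [exact: cf|exact: cg].
- by apply: cvgM; [exact: cf|exact: cg].
- by apply: cvgV => //; exact: cf.
Qed.

Let is_derive_scale_shift (a b : R) :
  is_derive (0 : R) (1 : R) (fun h : R => h * a + b) a.
Proof.
rewrite -[X in is_derive _ _ _ X]addr0; apply: is_deriveDf.
have := is_deriveMf (is_derive_id (0 : R) (1 : R)) (is_derive_cst a (0 : R) (1 : R)).
by rewrite mulr0 mul1r addr0.
Qed.

Lemma is_derive_fst w (v : R * R) : is_derive w v (fun z : R * R => z.1) v.1.
Proof. exact/is_derive_line/is_derive_scale_shift. Qed.

Lemma is_derive_snd w (v : R * R) : is_derive w v (fun z : R * R => z.2) v.2.
Proof. exact/is_derive_line/is_derive_scale_shift. Qed.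

Lemma rational_derive f (i : 'I_2) : rational_fun f ->
  exists2 g, rational_fun g & forall w, is_derive w (axis R i) f (g w).
Proof.
elim=> {f} [c|||f g rf [f' rf' hf] rg [g' rg' hg]
  |f g rf [f' rf' hf] rg [g' rg' hg]|f rf [f' rf' hf] f0].
- by exists (fun=> 0) => [|w]; [exact: rational_cst|exact: is_derive_cst].
- exists (fun=> (axis R i).1) => [|w]; first exact: rational_cst.
  exact: is_derive_fst.
- exists (fun=> (axis R i).2) => [|w]; first exact: rational_cst.
  exact: is_derive_snd.
- exists (fun w => f' w + g' w) => [|w]; first exact: rational_add.
  exact: is_deriveDf.
- exists (fun w => f' w * g w + f w * g' w) => [|w].
    by apply: rational_add; exact: rational_mul.
  exact: is_deriveMf.
- exists (fun w => - f' w / f w ^+ 2) => [|w]; last exact: is_deriveVf.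
  apply: rational_div; [exact: rational_opp|exact: rational_sqr|].
  by move=> w; rewrite expf_neq0.
Qed.

Lemma rational_Csmooth f : rational_fun f -> Csmooth f.
Proof.
move=> rf k; elim: k f rf => [|k IH] f rf /=.
  exact/continuous_subspaceT/rational_continuous.
split; first exact/continuous_subspaceT/rational_continuous.
move=> i; have [g rg hg] := rational_derive i rf.
split=> [w _|]; first by have [] := hg w.
exists g; last exact: IH.
by move=> w _; have [_ ->] := hg w.
Qed.

End RationalFunctions.

(** * From the regularity classes on the closed disc to continuous extensions and their
    derivatives *)

Section Regularity.
Variable R : realType.
Implicit Types (w : R * R) (f g : R * R -> R).

Let cont f := {within @cdisc R, continuous f}.

Lemma hoelder_continuous (b : R) f : 0 < b -> hoelder_cont b f -> cont f.
Proof.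
move=> b0 [C hC]; apply/subspace_continuousP => w Dw.
apply/cvgrPdist_lt => e e0.
have C0 : 0 < `|C| + 1 by rewrite ltr_wpDl.
(* The radius is chosen so that [(|C| + 1) * d ^ b = e]. *)
pose d := (e / (`|C| + 1)) `^ b^-1.
have d0 : 0 < d by rewrite powR_gt0// divr_gt0.
have db : d `^ b = e / (`|C| + 1).
  by rewrite /d -powRrM mulVf ?gt_eqF// powRr1// ltW// divr_gt0.
rewrite near_withinE; near=> z => Dz.
have zd : Defs.edist w z < d.
  (* Balls of [R * R] are squares; radius [d / 2] keeps the Euclidean distance below [d], because
     [sqrt 2 / 2 < 1]. *)
  have [] : ball w (d / 2) z by near: z; apply: nbhsx_ballx; rewrite divr_gt0.
  rewrite /ball /= /Defs.edist !ltr_norml => h1 h2.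
  have -> : d = Num.sqrt (d ^+ 2) by rewrite sqrtr_sqr gtr0_norm.
  by rewrite ltr_sqrt ?exprn_gt0//; nra.
apply: (le_lt_trans (hC _ _ Dw Dz)).
apply: (@le_lt_trans _ _ (`|C| * Defs.edist w z `^ b)).
  by rewrite ler_wpM2r ?powR_ge0// ler_norm.
apply: (@le_lt_trans _ _ (`|C| * d `^ b)).
  by rewrite ler_wpM2l// ge0_ler_powR ?nnegrE ?sqrtr_ge0 ?ltW.
by rewrite db mulrA ltr_pdivrMr// mulrC ltr_pM2l// ltrDl.
Unshelve. all: by end_near. Qed.

Lemma regular_sub (P Q : (R * R -> R) -> Prop) k f :
  (forall g, P g -> Q g) -> regular P k f -> regular Q k f.
Proof.
move=> PQ; elim: k f => [|k IH] f /=; first exact: PQ.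
move=> [cf h]; split => // i; have [h1 [g hg rg]] := h i.
by split=> //; exists g => //; exact: IH.
Qed.

Lemma regular_pred k f : regular cont k.+1 f -> regular cont k f.
Proof.
elim: k f => [|k IH] f /=; first by case.
move=> [cf h]; split => // i; have [h1 [g hg rg]] := h i.
by split=> //; exists g => //; exact: IH.
Qed.

Lemma regular_le k l f : (k <= l)%N -> regular cont l f -> regular cont k f.
Proof.
elim: l => [|l IH]; first by rewrite leqn0 => /eqP ->.
rewrite leq_eqVlt => /predU1P[->//|kl rf].
by apply: IH => //; exact: regular_pred.
Qed.

(* Encodes "C^1 up to the boundary of the disc": [f] and [g] are continuous on
   the whole plane, but [g] is the gradient of [f] on the open disc only. *)
Definition C1 f (g : 'I_2 -> R * R -> R) :=
  [/\ continuous f, forall i, continuous (g i) &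
    forall w i, disc w -> is_derive w (axis R i) f (g i w)].

Lemma disc_near w : disc w -> \forall z \near w, disc z.
Proof. by move=> Dw; apply: open_nbhs_nbhs; split => //; exact: open_disc. Qed.

Lemma is_derive_disc f g w v df : disc w -> (forall z, disc z -> f z = g z) ->
  is_derive w v f df -> is_derive w v g df.
Proof.
move=> Dw fg; apply: near_eq_is_derive.
by apply: filterS (disc_near Dw) => z /fg.
Qed.

Lemma regular1_ext f : regular cont 1 f ->
  exists F G, C1 F G /\ forall w, disc w -> F w = f w.
Proof.
move=> [cf h].
have [F cF FE] := within_cdisc_ext cf.
have hG i : exists G, continuous G /\ forall w, disc w -> G w = 'D_(axis R i) f w.
  have [_ [g gD cg]] := h i; have [G cG GE] := within_cdisc_ext cg.
  exists G; split => // w Dw; rewrite GE ?gD//; exact: disc_cdisc.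
have [G hG'] := choice hG.
exists F, G; split; last by move=> w /disc_cdisc /FE.
split => [//|i|w i Dw]; first by have [] := hG' i.
have [_ ->//] := hG' i.
apply: (@is_derive_disc f) => // [z /disc_cdisc /FE//|].
by apply: derivableP; have [h1 _] := h i; exact: h1.
Qed.

Lemma regular2_ext f : regular cont 2 f ->
  exists F G H, [/\ C1 F G, forall i, C1 (G i) (H i) & forall w, disc w -> F w = f w].
Proof.
move=> /= [cf h].
have [F cF FE] := within_cdisc_ext cf.
have hG i : exists G, exists H, C1 G H /\ forall w, disc w -> G w = 'D_(axis R i) f w.
  have [_ [g gD rg]] := h i; have [G [H [GH GE]]] := regular1_ext rg.
  by exists G, H; split => // w Dw; rewrite GE ?gD.
have [G hG'] := choice hG; have [H hH] := choice hG'.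
exists F, G, H; split.
- split => [//|i|w i Dw]; first by have [[]] := hH i.
  have [_ ->//] := hH i.
  apply: (@is_derive_disc f) => // [z /disc_cdisc /FE//|].
  by apply: derivableP; have [h1 _] := h i; exact: h1.
- by move=> i; have [] := hH i.
- by move=> w /disc_cdisc /FE.
Qed.

Lemma Ckb_ext k b f : (2 <= k)%N -> 0 < b -> Ckb k b f ->
  exists F G H, [/\ C1 F G, forall i, C1 (G i) (H i) & forall w, disc w -> F w = f w].
Proof.
move=> k2 b0 rf; apply: regular2_ext; apply: (regular_le k2).
apply: regular_sub rf => g; exact: hoelder_continuous.
Qed.

(** At a point of the open disc the filter in [pd] is the full neighbourhood filter, so the limit of
    the derivatives is the value of their continuous representative [g]. *)
Lemma pdE f g (i : 'I_2) w : disc w -> continuous g ->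
  (forall z, disc z -> is_derive z (axis R i) f (g z)) -> pd i f w = g w.
Proof.
move=> Dw cg h; rewrite /pd.
have wD : within (@disc R) (nbhs w) = nbhs w by apply: within_interior; exact: disc_near.
rewrite wD; apply: cvg_lim => //; apply: cvg_trans (cg w).
apply: near_eq_cvg; apply: filterS (disc_near Dw) => z /h[_ dz].
by rewrite dz.
Qed.

Lemma C1_add f (f' : 'I_2 -> R * R -> R) g (g' : 'I_2 -> R * R -> R) :
  C1 f f' -> C1 g g' ->
  C1 (fun w => f w + g w) (fun i w => f' i w + g' i w).
Proof.
move=> [cf cf' df] [cg cg' dg]; split.
- by move=> w; apply: cvgD; [exact: cf|exact: cg].
- by move=> i w; apply: cvgD; [exact: cf'|exact: cg'].
- by move=> w i Dw; apply: is_deriveDf; [exact: df|exact: dg].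
Qed.

Lemma C1_mul f (f' : 'I_2 -> R * R -> R) g (g' : 'I_2 -> R * R -> R) :
  C1 f f' -> C1 g g' ->
  C1 (fun w => f w * g w) (fun i w => f' i w * g w + f w * g' i w).
Proof.
move=> [cf cf' df] [cg cg' dg]; split.
- by move=> w; apply: cvgM; [exact: cf|exact: cg].
- move=> i w; apply: cvgD; apply: cvgM;
    by [exact: cf|exact: cg|exact: cf'|exact: cg'].
- by move=> w i Dw; apply: is_deriveMf; [exact: df|exact: dg].
Qed.

Lemma C1_cst (c : R) : C1 (fun=> c) (fun i _ => 0).
Proof.
split=> [w|i w|w i _]; [exact: cvg_cst|exact: cvg_cst|exact: is_derive_cst].
Qed.

Lemma C1_sum (I : Type) (r : seq I) (f : I -> R * R -> R)
    (f' : I -> 'I_2 -> R * R -> R) :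
  (forall j, C1 (f j) (f' j)) ->
  C1 (fun w => \sum_(j <- r) f j w) (fun i w => \sum_(j <- r) f' j i w).
Proof.
move=> h; elim: r => [|j r IH].
  under eq_fun do rewrite big_nil.
  rewrite [X in C1 _ X](_ : _ = fun i _ => 0); first exact: C1_cst.
  by apply/funext => i; apply/funext => w; rewrite big_nil.
under eq_fun do rewrite big_cons.
rewrite [X in C1 _ X](_ : _ = fun i w => f' j i w + \sum_(j <- r) f' j i w).
  exact: C1_add.
by apply/funext => i; apply/funext => w; rewrite big_cons.
Qed.

End Regularity.

(** * Integration over the disc: integrability, the fundamental theorem on chords, Fubini *)

Section Integration.
Variable R : realType.
Implicit Types (w : R * R) (f g : R * R -> R).

Local Notation mu2 := (@lebesgue2 R).
Local Notation box := (`[-1, 1]%classic `*` `[-1, 1]%classic : set (R * R)).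

Lemma lebesgue2_itv (a b c d : R) : a <= b -> c <= d ->
  mu2 (`[a, b]%classic `*` `[c, d]%classic) = ((b - a) * (d - c))%:E.
Proof.
move=> ab cd; rewrite /lebesgue2 product_measure1E; [|exact: measurable_itv..].
have len (x y : R) : x <= y ->
    (@lebesgue_measure R) `[x, y]%classic = (y - x)%:E.
  move=> xy; rewrite lebesgue_measure_itv /= lte_fin.
  by case: ltgtP xy => // -> _; rewrite subrr.
by rewrite -[LHS]/(lebesgue_measure `[a, b]%classic * lebesgue_measure `[c, d]%classic)%E !len.
Qed.

Lemma lebesgue2_disc : (mu2 (@disc R) <= 4%:E)%E.
Proof.
have <- : mu2 box = 4%:E.
  by rewrite lebesgue2_itv; [congr EFin; lra|lra..].
apply: le_measure; rewrite ?inE; [exact: measurable_disc| |].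
  by apply: measurableX; exact: measurable_itv.
by move=> w /disc_cdisc/cdisc_box[h1 h2]; split; rewrite /= in_itv.
Qed.

Lemma lebesgue2_disc_lty : (mu2 (@disc R) < +oo)%E.
Proof. exact: le_lt_trans lebesgue2_disc (ltry _). Qed.

Lemma integrable_disc_bounded f M : measurable_fun setT f ->
  (forall w, disc w -> `|f w| <= M) -> mu2.-integrable (@disc R) (EFin \o f).
Proof.
move=> mf fM; apply: measurable_bounded_integrable.
- exact: measurable_disc.
- exact: lebesgue2_disc_lty.
- exact: measurable_funTS.
- exists M; split; first exact: num_real.
  by move=> x Mx w Dw; exact: le_trans (fM _ Dw) (ltW Mx).
Qed.

Lemma integrable_disc f : continuous f -> mu2.-integrable (@disc R) (EFin \o f).
Proof.
move=> cf; have [M _ hM] := continuous_bounded_cdisc cf.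
apply: (@integrable_disc_bounded _ M); first exact: continuous_measurable_plane.
by move=> w /disc_cdisc /hM.
Qed.

(** The domain is empty or the open chord from [-r] to [r] with [r = sqrt (1 - y ^ 2)]. The
    fundamental theorem of calculus leaves the values of [phi] at the two end points, which lie on
    the circle. *)
Lemma chord_integral (y : R) (phi dphi : R -> R) :
  continuous phi -> continuous dphi ->
  (forall x, x ^+ 2 + y ^+ 2 < 1 -> is_derive x (1 : R) phi (dphi x)) ->
  (forall x, x ^+ 2 + y ^+ 2 = 1 -> phi x = 0) ->
  (\int[@lebesgue_measure R]_(x in [set x | x ^+ 2 + y ^+ 2 < 1]%R) (dphi x)%:E = 0)%E.
Proof.
move=> cphi cdphi dE phi0.
have [y1|y1] := ltP (y ^+ 2) 1; last first.
  rewrite (_ : [set _ | _] = set0) ?integral_set0//.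
  by apply/seteqP; split => x //= h; have := sqr_ge0 x; lra.
set r := Num.sqrt (1 - y ^+ 2).
have r0 : 0 < r by rewrite sqrtr_gt0 subr_gt0.
have r2 : r ^+ 2 = 1 - y ^+ 2 by rewrite sqr_sqrtr// subr_ge0 ltW.
have -> : [set x | x ^+ 2 + y ^+ 2 < 1] = `]-r, r[%classic.
  by apply/seteqP; split => x /=; rewrite in_itv /= => h; [apply/andP; split|]; nra.
rewrite -(@integral_itv_bndoo _ _ _ _ true false); last first.
  apply: measurable_funTS; apply/measurable_EFinP.
  exact: continuous_measurable_fun.
rewrite (@continuous_FTC2 _ dphi phi).
- by rewrite !phi0 ?sqrrN ?r2 ?subrK// subee.
- by lra.
- exact: continuous_subspaceT.
- split.
  + move=> x; rewrite in_itv /= => /andP[h1 h2].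
    by have [] : is_derive x (1 : R) phi (dphi x) by apply: dE; nra.
  + exact/cvg_at_right_filter/cphi.
  + exact/cvg_at_left_filter/cphi.
- move=> x; rewrite in_itv /= => /andP[h1 h2]; rewrite derive1E.
  by have [] : is_derive x (1 : R) phi (dphi x) by apply: dE; nra.
Qed.

Lemma continuous_slice1 f (y : R) : continuous f -> continuous (fun x => f (x, y)).
Proof.
move=> cf x; apply: (@cvg_comp _ _ _ (fun x => (x, y)) f _ (nbhs (x, y)));
  last exact: cf.
by apply: (@cvg_pair _ _ _ _ (nbhs x) (nbhs y)); [exact: cvg_id|exact: cvg_cst].
Qed.

Lemma continuous_slice2 f (x : R) : continuous f -> continuous (fun y => f (x, y)).
Proof.
move=> cf y; apply: (@cvg_comp _ _ _ (fun y => (x, y)) f _ (nbhs (x, y)));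
  last exact: cf.
by apply: (@cvg_pair _ _ _ _ (nbhs x) (nbhs y)); [exact: cvg_cst|exact: cvg_id].
Qed.

Let axis0E (h x y : R) : h *: axis R 0 + (x, y) = (h + x, y).
Proof.
by transitivity (h * 1 + x, h * 0 + y) => //; rewrite mulr1 mulr0 add0r.
Qed.

Let axis1E (h x y : R) : h *: axis R 1 + (x, y) = (x, h + y).
Proof.
by transitivity (h * 0 + x, h * 1 + y) => //; rewrite mulr1 mulr0 add0r.
Qed.

Lemma is_derive_slice1 f (x y d : R) :
  is_derive (x, y) (axis R 0) f d -> is_derive x (1 : R) (fun x => f (x, y)) d.
Proof.
have -> : (fun x => f (x, y)) = fun h : R => f (h *: axis R 0 + (0, y)).
  by apply/funext => h; rewrite axis0E addr0.
by move=> h; apply: is_derive_affine; rewrite axis0E addr0.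
Qed.

Lemma is_derive_slice2 f (x y d : R) :
  is_derive (x, y) (axis R 1) f d -> is_derive y (1 : R) (fun y => f (x, y)) d.
Proof.
have -> : (fun y => f (x, y)) = fun h : R => f (h *: axis R 1 + (x, 0)).
  by apply/funext => h; rewrite axis1E addr0.
by move=> h; apply: is_derive_affine; rewrite axis1E addr0.
Qed.

(** By Fubini the integral is taken first along the chords parallel to the axis [i], and each of
    these vanishes by [chord_integral]. *)
Lemma integral_partial_disc f (f' : 'I_2 -> R * R -> R) i : C1 f f' ->
  (forall w, w.1 ^+ 2 + w.2 ^+ 2 = 1 -> f w = 0) ->
  (\int[mu2]_(w in @disc R) (f' i w)%:E = 0)%E.
Proof.
move=> [cf cf' df] f0.
have intf : mu2.-integrable setT ((EFin \o f' i) \_ (@disc R)).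
  apply/integrable_restrict => //; rewrite ?setTI; first exact: measurable_disc.
  by apply: integrable_disc; exact: cf'.
rewrite integral_mkcond.
case: i intf => [[|[|//]] hi] intf.
- have iE : Ordinal hi = 0 :> 'I_2 by exact: val_inj.
  rewrite iE in intf *; rewrite -integral21_prod_meas1//.
  rewrite [LHS](_ : _ = \int[@lebesgue_measure R]_y 0)%E; last first.
    apply: eq_integral => y _; rewrite /fubini_G.
    rewrite -[RHS](@chord_integral y (fun x => f (x, y)) (fun x => f' 0 (x, y))).
    + by rewrite [RHS]integral_mkcond; apply: eq_integral.
    + exact: continuous_slice1.
    + exact: continuous_slice1.
    + by move=> x h; apply: is_derive_slice1; exact: df.
    + by move=> x h; exact: f0.
  by rewrite integral0.
- have iE : Ordinal hi = 1 :> 'I_2 by exact: val_inj.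
  rewrite iE in intf *; rewrite -integral12_prod_meas1//.
  rewrite [LHS](_ : _ = \int[@lebesgue_measure R]_y 0)%E; last first.
    apply: eq_integral => x _; rewrite /fubini_F.
    rewrite -[RHS](@chord_integral x (fun y => f (x, y)) (fun y => f' 1 (x, y))).
    + rewrite [RHS]integral_mkcond; apply: eq_integral => y _.
      rewrite !patchE; congr (if _ then _ else _).
      by apply/idP/idP; rewrite !inE /disc /= addrC.
    + exact: continuous_slice2.
    + exact: continuous_slice2.
    + by move=> y h; apply: is_derive_slice2; apply: df; rewrite /disc /= addrC.
    + by move=> y h; apply: f0; rewrite /= addrC.
  by rewrite integral0.
Qed.

End Integration.

(** * Bounds, uniform in pole and regularization, for the integral of the product kernel *)

Section Kernel.
Variable R : realType.
Variables (t d : R).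
Hypotheses (t0 : 0 < t) (t12 : 2 * t < 1) (d0 : 0 < d) (d1 : d <= 1).

Local Notation mu := (@lebesgue_measure R).

Let alpha (a x : R) := (x - a) ^+ 2 + d.

Let alpha_gt0 a x : 0 < alpha a x.
Proof. by rewrite ltr_wpDl// sqr_ge0. Qed.

Let is_derive_alpha a x : is_derive x (1 : R) (alpha a) (2 * (x - a)).
Proof.
have h : is_derive x (1 : R) (fun z : R => z - a) 1 := is_derive_shift x 1 (- a).
apply: (@is_derive_eq _ _ _ _ _ _ _ ((1 * (x - a) + (x - a) * 1) + 0)); last by ring.
exact: is_deriveDf (is_deriveMf h h) (is_derive_cst d x 1).
Qed.

Let is_derive_alpha_powR a s x :
  is_derive x (1 : R) (fun x => alpha a x `^ s)
    (s * alpha a x `^ (s - 1) * (2 * (x - a))).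
Proof.
apply: (is_derive_comp1 (phi := fun y => y `^ s)) => //.
by apply: is_derive1_powR; exact: alpha_gt0.
Qed.

Let is_derive_continuous (f df : R -> R) :
  (forall x, is_derive x (1 : R) f (df x)) -> continuous f.
Proof.
move=> h x; apply: differentiable_continuous; apply/derivable1_diffP.
by have [] := h x.
Qed.

Lemma continuous_sqrD_powR a s : continuous (fun x => alpha a x `^ s).
Proof. exact: is_derive_continuous (is_derive_alpha_powR a s). Qed.

(* [(x - a) alpha^(-t)] has derivative at least [(1 - 2 t) alpha^(-t)]. *)
Lemma integral_sqrD_powR_le (a : R) : -1 <= a <= 1 ->
  (\int[mu]_(x in `[(-1)%R, 1%R]) (alpha a x `^ (- t))%:E <= (10 / (1 - 2 * t))%:E)%E.
Proof.
move=> /andP[a1 a2].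
have c0 : 0 < 1 - 2 * t by rewrite subr_gt0.
pose F x := (1 - 2 * t)^-1 * ((x - a) * alpha a x `^ (- t)).
pose G x := (1 - 2 * t)^-1 *
  (1 * alpha a x `^ (- t) + (x - a) * (- t * alpha a x `^ (- t - 1) * (2 * (x - a)))).
have dF x : is_derive x (1 : R) F (G x).
  have h : is_derive x (1 : R) (fun z : R => z - a) 1 := is_derive_shift x 1 (- a).
  have hc := is_derive_cst (1 - 2 * t)^-1 x (1 : R).
  have := is_deriveMf hc (is_deriveMf h (is_derive_alpha_powR a (- t) x)).
  by rewrite mul0r add0r.
have cA s : continuous (fun x => alpha a x `^ s) by exact: continuous_sqrD_powR.
have cI : continuous (fun x : R => x - a).
  by move=> x; apply: cvgB; [exact: cvg_id|exact: cvg_cst].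
have cG : continuous G.
  move=> x; apply: cvgM; first exact: cvg_cst.
  apply: cvgD; first by apply: cvgM; [exact: cvg_cst|exact: cA].
  apply: cvgM; first exact: cI.
  apply: cvgM; first by apply: cvgM; [exact: cvg_cst|exact: cA].
  by apply: cvgM; [exact: cvg_cst|exact: cI].
have le_G x : alpha a x `^ (- t) <= G x.
  rewrite /G mulrC ler_pdivlMr// mul1r.
  have -> : alpha a x `^ (- t) = alpha a x `^ (- t - 1) * alpha a x.
    rewrite -[X in _ * X](powRr1 (ltW (alpha_gt0 a x))).
    by rewrite -powRD ?subrK// (gt_eqF (alpha_gt0 a x)) implybT.
  have := powR_ge0 (alpha a x) (- t - 1).
  move: (_ `^ _) => u u0; rewrite /alpha.
  rewrite -subr_ge0 (_ : _ - _ = 2 * t * d * u); last by ring.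
  by rewrite !mulr_ge0// ltW.
(* Since [|x - a| <= alpha ^ (1/2)], the product [|x - a| alpha ^ (- t)] is at most
   [alpha ^ (1/2 - t)]. On the interval [alpha <= 4 + d <= 5], and the exponent lies between 0 and
   1. The two end points together give the constant 10. *)
have F5 x : -1 <= x <= 1 -> `|F x| <= 5 / (1 - 2 * t).
  move=> /andP[x1 x2]; rewrite /F normrM gtr0_norm ?invr_gt0// mulrC.
  rewrite ler_wpM2r ?invr_ge0 ?(ltW c0)// normrM (ger0_norm (powR_ge0 _ _)).
  have hx : `|x - a| <= alpha a x `^ 2^-1.
    rewrite powR12_sqrt ?(ltW (alpha_gt0 a x))// -sqrtr_sqr ler_wsqrtr//.
    by rewrite lerDl ltW.
  apply: (le_trans (ler_wpM2r (powR_ge0 _ _) hx)).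
  rewrite -powRD; last by rewrite (gt_eqF (alpha_gt0 a x)) implybT.
  apply: (@le_trans _ _ (5 `^ (2^-1 - t))).
    rewrite ge0_ler_powR ?nnegrE ?(ltW (alpha_gt0 a x))//.
      by have := t12; lra.
    by rewrite /alpha; have := d1; nra.
  by rewrite -[leRHS]powRr1//; apply: ler_powR; have := t0; lra.
apply: (@le_trans _ _ (\int[mu]_(x in `[(-1)%R, 1%R]) (G x)%:E)%E).
  apply: ge0_le_integral => //=.
  - by move=> x _; rewrite lee_fin powR_ge0.
  - apply: measurable_funTS; apply/measurable_EFinP.
    exact: continuous_measurable_fun.
  - apply: measurable_funTS; apply/measurable_EFinP.
    exact: continuous_measurable_fun.
  - by move=> x _; rewrite lee_fin.
rewrite (@continuous_FTC2 _ G F).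
- rewrite -EFinB lee_fin.
  have := F5 1 ltac:(lra); have := F5 (-1) ltac:(lra).
  rewrite !ler_norml => /andP[h1 _] /andP[_ h2].
  by move: h1 h2; move: (_^-1) => u; lra.
- by lra.
- exact: continuous_subspaceT.
- have cF : continuous F by exact: is_derive_continuous dF.
  split.
  + by move=> x _; have [] := dF x.
  + exact/cvg_at_right_filter/cF.
  + exact/cvg_at_left_filter/cF.
- by move=> x _; rewrite derive1E; have [] := dF x.
Qed.

(** The disc lies in the square of side 2, on which the kernel is a product of functions of one
    variable each; Tonelli reduces the integral to two one-dimensional ones. *)
Lemma integral_kernel_disc (a b : R) : -1 <= a <= 1 -> -1 <= b <= 1 ->
  (\int[@lebesgue2 R]_(w in @disc R)
    ((alpha a w.1 * alpha b w.2) `^ (- t))%:E <= ((10 / (1 - 2 * t)) ^+ 2)%:E)%E.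
Proof.
move=> a1 b1.
pose I : set R := `[-1, 1]%classic.
pose h (z : R * R) : \bar R :=
  (((fun x => alpha a x `^ (- t)) \_ I) z.1 * ((fun x => alpha b x `^ (- t)) \_ I) z.2)%:E.
have m1 c : measurable_fun setT ((fun x => alpha c x `^ (- t)) \_ I).
  apply/(measurable_restrictT _ _).1; first exact: measurable_itv.
  apply: measurable_funTS; apply: continuous_measurable_fun.
  exact: continuous_sqrD_powR.
have g0 c x : 0 <= ((fun x => alpha c x `^ (- t)) \_ I) x.
  by rewrite patchE; case: ifP => // _; exact: powR_ge0.
have h0 z : (0 <= h z)%E by rewrite lee_fin mulr_ge0.
have mh : measurable_fun setT h.
  apply/measurable_EFinP; apply: measurable_funM.
    exact: measurableT_comp (m1 a) measurable_fst.
  exact: measurableT_comp (m1 b) measurable_snd.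
have intI c : -1 <= c <= 1 ->
    (\int[mu]_x (((fun x => alpha c x `^ (- t)) \_ I) x)%:E <= (10 / (1 - 2 * t))%:E)%E.
  move=> c1; apply: le_trans (integral_sqrD_powR_le c1).
  by rewrite [leRHS]integral_mkcond restrict_EFin.
apply: (@le_trans _ _ (\int[@lebesgue2 R]_z h z)%E).
  apply: (@le_trans _ _ (\int[@lebesgue2 R]_(z in @disc R) h z)%E); last first.
    by apply: ge0_subset_integral => //; exact: measurable_disc.
  rewrite le_eqVlt; apply/orP; left; apply/eqP; apply: eq_integral => w.
  rewrite inE => /disc_cdisc/cdisc_box[w1 w2].
  rewrite /h !patchE !mem_set /= ?in_itv //= powRM ?(ltW (alpha_gt0 _ _))//.
rewrite fubini_tonelli1//=.
rewrite [leLHS](_ : _ = \int[mu]_x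
    ((((fun x => alpha a x `^ (- t))%R \_ I) x)%:E *
    \int[mu]_y (((fun x => alpha b x `^ (- t))%R \_ I) y)%:E))%E; last first.
  apply: eq_integral => x _; rewrite /fubini_F /h /=.
  under eq_integral do rewrite EFinM.
  by rewrite ge0_integralZl_EFin//; [move=> y _; rewrite lee_fin|by apply/measurable_EFinP; exact: m1].
rewrite ge0_integralZr//; [|by apply/measurable_EFinP; exact: m1|by move=> x _; rewrite lee_fin|
  by apply: integral_ge0 => y _; rewrite lee_fin].
rewrite expr2 EFinM lee_pmul//; try exact: intI.
- by apply: integral_ge0 => y _; rewrite lee_fin.
- by apply: integral_ge0 => y _; rewrite lee_fin.
Qed.

End Kernel.

(** * Hoelder's inequality against a function dominated by the kernel *)

Section Pairing.
Variable R : realType.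
Implicit Types (f g : R * R -> R).

Local Notation mu2 := (@lebesgue2 R).

Lemma measurable_restrict_disc f : continuous f -> measurable_fun setT (f \_ (@disc R)).
Proof.
move=> cf; apply/(measurable_restrictT _ _).1; first exact: measurable_disc.
by apply: measurable_funTS; exact: continuous_measurable_plane.
Qed.

(** The norm of exponent [+oo] unfolds to the essential supremum under this positivity. *)
Lemma lebesgue2_gt0 : (0 < mu2 setT)%E.
Proof.
apply: (@lt_le_trans _ _ (mu2 (`[-1, 1]%classic `*` `[-1, 1]%classic))).
  by rewrite lebesgue2_itv ?lte_fin; lra.
by apply: le_measure; rewrite ?inE//; apply: measurableX; exact: measurable_itv.
Qed.

Section KernelBound.
Variables (m a b d : R) (f g : R * R -> R).
Hypotheses (m0 : 0 <= m) (ha : -1 <= a <= 1) (hb : -1 <= b <= 1).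
Hypotheses (d0 : 0 < d) (d1 : d <= 1).
Hypotheses (cf : continuous f) (cg : continuous g).

Let ker (w : R * R) := ((w.1 - a) ^+ 2 + d) * ((w.2 - b) ^+ 2 + d).
Hypothesis gm : forall w, disc w -> `|g w| <= m * ker w `^ (- 4^-1).

Let ker_ge0 w : 0 <= ker w.
Proof. by rewrite mulr_ge0// addr_ge0 ?sqr_ge0 ?(ltW d0). Qed.

Lemma continuous_ker_powR s : continuous (fun w => ker w `^ s).
Proof.
have -> : (fun w => ker w `^ s) = (fun w : R * R =>
    (((w.1 - a) ^+ 2 + d) `^ s) * (((w.2 - b) ^+ 2 + d) `^ s)).
  by apply/funext => w; rewrite powRM// addr_ge0 ?sqr_ge0 ?(ltW d0).
move=> w; apply: cvgM.
  apply: (@cvg_comp _ _ _ fst (fun x : R => ((x - a) ^+ 2 + d) `^ s) _ (nbhs w.1)).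
    exact: cvg_fst.
  exact: continuous_sqrD_powR.
apply: (@cvg_comp _ _ _ snd (fun x : R => ((x - b) ^+ 2 + d) `^ s) _ (nbhs w.2)).
  exact: cvg_snd.
exact: continuous_sqrD_powR.
Qed.

(** Raising the bound [gm] to the power [q] turns the exponent [-1/4] of the kernel into [- t] with
    [t = q / 4], and [q < 2] is the condition [2 * t < 1] for the kernel integral. *)
Lemma integral_powR_le q : 0 < q < 2 ->
  (\int[mu2]_(w in @disc R) (`|g w| `^ q)%:E <=
    (m `^ q * (10 / (1 - 2 * (q / 4))) ^+ 2)%:E)%E.
Proof.
move=> /andP[q0 q2].
apply: (@le_trans _ _ (\int[mu2]_(w in @disc R)
    ((m `^ q)%:E * (ker w `^ (- (q / 4)))%:E))%E).
  apply: ge0_le_integral.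
  - exact: measurable_disc.
  - by move=> w _; rewrite lee_fin powR_ge0.
  - apply: measurable_funTS; apply/measurable_EFinP.
    apply: (@measurableT_comp _ _ _ _ _ _ (@powR R ^~ q)) => //.
    by apply: measurableT_comp => //; exact: continuous_measurable_plane.
  - apply: measurable_funTS; apply/measurable_EFinP.
    apply: measurable_funM => //; apply: continuous_measurable_plane.
    exact: continuous_ker_powR.
  - move=> w Dw; rewrite -EFinM lee_fin.
    have -> : - (q / 4) = - 4^-1 * q by lra.
    rewrite powRrM -powRM ?powR_ge0//.
    by rewrite ge0_ler_powR ?nnegrE ?mulr_ge0 ?powR_ge0 ?(ltW q0) ?gm.
rewrite ge0_integralZl_EFin ?powR_ge0//; last 3 first.
- exact: measurable_disc.
- by move=> w _; rewrite lee_fin powR_ge0.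
- apply: measurable_funTS; apply/measurable_EFinP.
  by apply: continuous_measurable_plane; exact: continuous_ker_powR.
rewrite EFinM lee_wpmul2l ?lee_fin ?powR_ge0//.
by apply: integral_kernel_disc => //; lra.
Qed.

(** The conjugate exponent is 1, and at [q = 1] the kernel constant is
    [(10 / (1 - 1/2)) ^ 2 = 400]. *)
Lemma pairing_ess_sup :
  (\int[mu2]_(w in @disc R) `|f w * g w|%:E <= (m * 400)%:E * Lp_disc +oo f)%E.
Proof.
have L0 : (0 <= Lp_disc +oo f)%E by exact: Lnorm_ge0.
apply: (@le_trans _ _ (\int[mu2]_(w in @disc R) (Lp_disc +oo f * `|g w|%:E))%E).
  apply: ae_ge0_le_integral.
  - exact: measurable_disc.
  - by move=> w _; rewrite lee_fin.
  - apply: measurable_funTS; apply/measurable_EFinP; apply: measurableT_comp => //.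
    by apply: measurable_funM; exact: continuous_measurable_plane.
  - by move=> w _; rewrite mule_ge0.
  - apply: measurable_funTS; apply: measurable_funeM; apply/measurable_EFinP.
    by apply: measurableT_comp => //; exact: continuous_measurable_plane.
  - have : {ae mu2, forall w, (abse \o (EFin \o (f \_ (@disc R)))) w <= Lp_disc +oo f}%E.
      rewrite /Lp_disc unlock lebesgue2_gt0; exact: ess_sup_ge.
    apply: filterS; first exact: (ae_filter_ringOfSetsType mu2).
    move=> w /= hw Dw; rewrite normrM EFinM.
    by apply: lee_wpmul2r => //; move: hw; rewrite patchE mem_set.
rewrite ge0_integralZl//; last 2 first.
- exact: measurable_disc.
- apply: measurable_funTS; apply/measurable_EFinP.
  by apply: measurableT_comp => //; exact: continuous_measurable_plane.
rewrite muleC lee_wpmul2r//.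
rewrite [leLHS](_ : _ = \int[mu2]_(w in @disc R) (`|g w| `^ 1)%:E)%E; last first.
  by apply: eq_integral => w _; rewrite powRr1.
apply: (le_trans (@integral_powR_le 1 ltac:(lra))).
rewrite powRr1// lee_fin ler_wpM2l//.
rewrite (_ : 1 - 2 * (1 / 4) = 2^-1 :> R) ?invrK; lra.
Qed.

(** Here [q] is the exponent conjugate to [p], and [2 < p] puts it below 2, where the kernel bound
    applies. *)
Lemma pairing_hoelder p q : 2 < p -> q = p / (p - 1) ->
  (\int[mu2]_(w in @disc R) `|f w * g w|%:E <=
    (m * ((10 / (1 - 2 * (q / 4))) ^+ 2) `^ q^-1)%:E * Lp_disc p%:E f)%E.
Proof.
move=> p2 qE.
have q12 : 0 < q < 2.
  by rewrite qE divr_gt0/= ?ltr_pdivrMr; lra.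
have /andP[q0 q2] := q12.
have pq : p^-1 + q^-1 = 1 by rewrite qE; field; apply/andP; split; lra.
have := @hoelder _ _ _ mu2 (f \_ (@disc R)) (g \_ (@disc R)) p q
  (measurable_restrict_disc cf) (measurable_restrict_disc cg) ltac:(lra) q0 pq.
rewrite Lnorm1 => h.
have -> : (\int[mu2]_(w in @disc R) `|f w * g w|%:E =
    \int[mu2]_w `|(EFin \o (f \_ (@disc R) \* g \_ (@disc R))%R) w|)%E.
  rewrite integral_mkcond; apply: eq_integral => w _ /=.
  by rewrite !patchE; case: ifP => // _; rewrite mul0r normr0.
apply: (le_trans h); rewrite muleC; apply: lee_wpmul2r; first exact: Lnorm_ge0.
rewrite unlock.
have -> : (\int[mu2]_x `|(EFin \o g \_ (@disc R)) x| `^ q =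
    \int[mu2]_(w in @disc R) (`|g w| `^ q)%:E)%E.
  rewrite [RHS]integral_mkcond; apply: eq_integral => w _ /=.
  by rewrite !patchE; case: ifP => // _; rewrite normr0 powR0// gt_eqF.
apply: (@le_trans _ _ ((m `^ q * (10 / (1 - 2 * (q / 4))) ^+ 2)%:E `^ q^-1)%E).
  apply: gt0_ler_poweR.
  - by rewrite invr_ge0 ltW.
  - rewrite in_itv /= leey andbT; apply: integral_ge0 => w _.
    by rewrite lee_fin powR_ge0.
  - by rewrite in_itv /= leey andbT lee_fin mulr_ge0 ?powR_ge0 ?sqr_ge0.
  - exact: integral_powR_le.
rewrite poweR_EFin lee_fin powRM ?powR_ge0 ?sqr_ge0//.
by rewrite -powRrM mulfV ?gt_eqF// powRr1.
Qed.

End KernelBound.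

(** One constant [K] serves every pole [(a, b)] and every regularization [d], so it survives the
    limit in which the regularization disappears. *)
Lemma pairing_bound (p : \bar R) : (2%:E < p)%E ->
  exists2 K : R, 0 < K & forall (m a b d : R) f g,
    0 <= m -> -1 <= a <= 1 -> -1 <= b <= 1 -> 0 < d -> d <= 1 ->
    continuous f -> continuous g ->
    (forall w, disc w -> `|g w| <=
      m * (((w.1 - a) ^+ 2 + d) * ((w.2 - b) ^+ 2 + d)) `^ (- 4^-1)) ->
    (\int[mu2]_(w in @disc R) `|f w * g w|%:E <= (m * K)%:E * Lp_disc p f)%E.
Proof.
case: p => [p|_|//].
  rewrite lte_fin => p2; set q := p / (p - 1).
  have q2 : q < 2 by rewrite /q ltr_pdivrMr; lra.
  exists (((10 / (1 - 2 * (q / 4))) ^+ 2) `^ q^-1).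
    by rewrite powR_gt0// exprn_gt0// divr_gt0//; lra.
  by move=> m a b d f g *; exact: (@pairing_hoelder m a b d).
exists 400; first by rewrite ltr0n.
by move=> m a b d f g *; exact: (@pairing_ess_sup m a b d).
Qed.

End Pairing.

(** * The regularized meromorphic test function: its derivatives, boundary values and size *)

Section TestFunctions.
Variable R : realType.
Implicit Types (w : R * R) (f g : R * R -> R).

Lemma C1_sub f (f' : 'I_2 -> R * R -> R) g (g' : 'I_2 -> R * R -> R) :
  C1 f f' -> C1 g g' ->
  C1 (fun w => f w - g w) (fun i w => f' i w - g' i w).
Proof.
move=> [cf cf' df] [cg cg' dg]; split.
- by move=> w; apply: cvgB; [exact: cf|exact: cg].
- by move=> i w; apply: cvgB; [exact: cf'|exact: cg'].
- by move=> w i Dw; have := df w i Dw; have := dg w i Dw => ? ?; exact: is_deriveB.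
Qed.

Lemma C1_inv f (f' : 'I_2 -> R * R -> R) : C1 f f' -> (forall w, f w != 0) ->
  C1 (fun w => (f w)^-1) (fun i w => - f' i w / f w ^+ 2).
Proof.
move=> [cf cf' df] f0; split.
- by move=> w; apply: cvgV => //; exact: cf.
- move=> i w; apply: cvgM; first by apply: cvgN; exact: cf'.
  by apply: cvgV; rewrite ?expf_neq0//; apply: cvgM; exact: cf.
- by move=> w i Dw; apply: is_deriveVf => //; exact: df.
Qed.

Lemma C1_fst : C1 (fun w => w.1) (fun i _ => (axis R i).1).
Proof.
split=> [w|i w|w i _]; [exact: cvg_fst|exact: cvg_cst|exact: is_derive_fst].
Qed.

Lemma C1_snd : C1 (fun w => w.2) (fun i _ => (axis R i).2).
Proof.
split=> [w|i w|w i _]; [exact: cvg_snd|exact: cvg_cst|exact: is_derive_snd].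
Qed.

Variables (a b c1 c2 s : R).
Hypothesis s0 : 0 < s.

Definition distE w := (w.1 - a) * (w.1 - a) + (w.2 - b) * (w.2 - b) + s.

(* [|1 - conj w0 * w|^2 + s] with [w0 = a + i b]. *)
Definition distD w := (1 - (a * w.1 + b * w.2)) * (1 - (a * w.1 + b * w.2)) +
  (b * w.1 - a * w.2) * (b * w.1 - a * w.2) + s.

(** In complex notation [re + i im = w - w0 |w|^2], which is [w] times the conjugate of
    [1 - conj w0 * w]: the numerator of [w / (1 - conj w0 * w)] once the denominator is made
    real. *)
Let re w := w.1 - a * (w.1 * w.1 + w.2 * w.2).
Let im w := w.2 - b * (w.1 * w.1 + w.2 * w.2).

(* With [c = c1 + i c2], [test_psi - i test_chi] regularizes
   [c / (w - w0) + conj c * w / (1 - conj w0 * w)], whose imaginary part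
   vanishes on the unit circle. *)
Definition test_psi w :=
  (c1 * (w.1 - a) + c2 * (w.2 - b)) * (distE w)^-1 +
  (c1 * re w + c2 * im w) * (distD w)^-1.

Definition test_chi w :=
  (c1 * (w.2 - b) - c2 * (w.1 - a)) * (distE w)^-1 -
  (c1 * im w - c2 * re w) * (distD w)^-1.

Lemma distE_gt0 w : 0 < distE w.
Proof. by rewrite /distE -!expr2 ltr_wpDl// addr_ge0 ?sqr_ge0. Qed.

Lemma distD_gt0 w : 0 < distD w.
Proof. by rewrite /distD -!expr2 ltr_wpDl// addr_ge0 ?sqr_ge0. Qed.

Let E0 w : distE w != 0. Proof. by rewrite gt_eqF ?distE_gt0. Qed.
Let D0 w : distD w != 0. Proof. by rewrite gt_eqF ?distD_gt0. Qed.

(** This is the identity [|1 - conj w0 * w|^2 - |w - w0|^2 = (1 - |w|^2) (1 - |w0|^2)]: the two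
    denominators agree on the unit circle and are ordered inside. *)
Lemma distDE w : distD w = distE w +
  (1 - (w.1 ^+ 2 + w.2 ^+ 2)) * (1 - (a ^+ 2 + b ^+ 2)).
Proof. by rewrite /distD /distE; ring. Qed.

Lemma distE_le_D w : disc w -> a ^+ 2 + b ^+ 2 < 1 -> distE w <= distD w.
Proof.
by rewrite /disc /= => h1 h2; rewrite distDE lerDl mulr_ge0// subr_ge0 ltW.
Qed.

Lemma rational_psi : rational_fun test_psi.
Proof.
have rc c := rational_cst (c : R).
have r1 := rational_fst R; have r2 := rational_snd R.
have rE : rational_fun distE.
  rewrite /distE; do ![exact: rc|exact: r1|exact: r2|apply: rational_sub
    |apply: rational_add|apply: rational_mul].
have rD : rational_fun distD.
  rewrite /distD; do ![exact: rc|exact: r1|exact: r2|apply: rational_sub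
    |apply: rational_add|apply: rational_mul].
have rEi := rational_inv rE E0; have rDi := rational_inv rD D0.
rewrite /test_psi; do ![exact: rc|exact: r1|exact: r2|exact: rEi|exact: rDi
  |apply: rational_sub|apply: rational_add|apply: rational_mul].
Qed.

(** On the circle [distD = distE], and [re], [im] become [w.1 - a], [w.2 - b], so the two fractions
    cancel. *)
Lemma chi_circle w : w.1 ^+ 2 + w.2 ^+ 2 = 1 -> test_chi w = 0.
Proof.
move=> h; rewrite /test_chi distDE /re /im -!expr2 h subrr mul0r addr0.
by rewrite -mulrBl [X in X / _](_ : _ = 0) ?mul0r//; ring.
Qed.

(** The two combinations are the real and imaginary parts of [2 dbar (test_psi - i test_chi)].
    Without regularization the function is holomorphic off the pole, so only terms carrying the
    factor [s] remain: [2 s (c / distE^2 - conj c * w0 * w / distD^2)]. *)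
Lemma psi_chi_C1 : exists psi' chi' : 'I_2 -> R * R -> R,
  [/\ C1 test_psi psi', C1 test_chi chi',
    forall w, psi' 0 w + chi' 1 w = 2 * s * c1 / distE w ^+ 2 -
      2 * s * (c1 * (a * w.1 - b * w.2) + c2 * (a * w.2 + b * w.1)) / distD w ^+ 2 &
    forall w, psi' 1 w - chi' 0 w = 2 * s * c2 / distE w ^+ 2 -
      2 * s * (c1 * (a * w.2 + b * w.1) - c2 * (a * w.1 - b * w.2)) / distD w ^+ 2].
Proof.
have kc c := @C1_cst R c.
have kx := C1_fst; have ky := C1_snd.
have kX := C1_sub kx (kc a); have kY := C1_sub ky (kc b).
have kE := C1_add (C1_add (C1_mul kX kX) (C1_mul kY kY)) (kc s).
have kP := C1_sub (kc 1) (C1_add (C1_mul (kc a) kx) (C1_mul (kc b) ky)).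
have kQ := C1_sub (C1_mul (kc b) kx) (C1_mul (kc a) ky).
have kD := C1_add (C1_add (C1_mul kP kP) (C1_mul kQ kQ)) (kc s).
have kr := C1_add (C1_mul kx kx) (C1_mul ky ky).
have kre := C1_sub kx (C1_mul (kc a) kr).
have kim := C1_sub ky (C1_mul (kc b) kr).
have kEi := C1_inv kE E0; have kDi := C1_inv kD D0.
eexists; eexists; split.
- exact: (C1_add
    (C1_mul (C1_add (C1_mul (kc c1) kX) (C1_mul (kc c2) kY)) kEi)
    (C1_mul (C1_add (C1_mul (kc c1) kre) (C1_mul (kc c2) kim)) kDi)).
- exact: (C1_sub
    (C1_mul (C1_sub (C1_mul (kc c1) kY) (C1_mul (kc c2) kX)) kEi)
    (C1_mul (C1_sub (C1_mul (kc c1) kim) (C1_mul (kc c2) kre)) kDi)).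
- move=> [x y]; have := E0 (x, y); have := D0 (x, y).
  rewrite /distE /distD /axis /= => hD hE.
  by field; rewrite hD hE.
- move=> [x y]; have := E0 (x, y); have := D0 (x, y).
  rewrite /distE /distD /axis /= => hD hE.
  by field; rewrite hD hE.
Qed.

Let m := Num.sqrt (c1 ^+ 2 + c2 ^+ 2).

Lemma ratio_bound (n G : R) : 0 < G -> n ^+ 2 <= (c1 ^+ 2 + c2 ^+ 2) * G ->
  `|n * G^-1| <= m * (Num.sqrt G)^-1.
Proof.
move=> G0 nG; have sG : 0 < Num.sqrt G by rewrite sqrtr_gt0.
rewrite normrM normfV (gtr0_norm G0) ler_pdivrMr//.
rewrite -[X in _ * X](sqr_sqrtr (ltW G0)) expr2 mulrA mulfVK ?gt_eqF//.
rewrite -sqrtr_sqr /m -sqrtrM ?addr_ge0 ?sqr_ge0//.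
exact: ler_wsqrtr.
Qed.

(** Each of the two fractions is at most [m / sqrt distE]: the numerators are estimated by
    Cauchy-Schwarz, and [distE <= distD] in the disc. Splitting [s] into halves writes
    [distE = al + be], and [al * be <= (al + be) ^ 2] produces the product kernel with exponent
    [-1/4]. *)
Lemma chi_bound w : disc w -> a ^+ 2 + b ^+ 2 < 1 ->
  `|test_chi w| <= 2 * m *
    (((w.1 - a) ^+ 2 + s / 2) * ((w.2 - b) ^+ 2 + s / 2)) `^ (- 4^-1).
Proof.
move=> Dw ab1.
have e0 := distE_gt0 w; have f0 := distD_gt0 w.
have m0 : 0 <= m by exact: sqrtr_ge0.
have h1 : `|(c1 * (w.2 - b) - c2 * (w.1 - a)) * (distE w)^-1| <=
    m * (Num.sqrt (distE w))^-1.
  apply: ratio_bound => //; rewrite /distE.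
  rewrite -subr_ge0 (_ : _ - _ = (c1 * (w.1 - a) + c2 * (w.2 - b)) ^+ 2 +
    (c1 ^+ 2 + c2 ^+ 2) * s); last by ring.
  by rewrite addr_ge0 ?sqr_ge0// mulr_ge0 ?(ltW s0)// addr_ge0 ?sqr_ge0.
have h2 : `|(c1 * im w - c2 * re w) * (distD w)^-1| <=
    m * (Num.sqrt (distE w))^-1.
  apply: (@le_trans _ _ (m * (Num.sqrt (distD w))^-1)); last first.
    rewrite ler_wpM2l// lef_pV2 ?posrE ?sqrtr_gt0//.
    by apply: ler_wsqrtr; exact: distE_le_D.
  apply: ratio_bound => //.
  have r1 : w.1 ^+ 2 + w.2 ^+ 2 <= 1 by exact: ltW.
  (* Here [re^2 + im^2 = |w|^2 (distD - s)], and the defect in Cauchy-Schwarz is the square of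
     [c1 re + c2 im]. *)
  apply: (@le_trans _ _ ((c1 ^+ 2 + c2 ^+ 2) * (w.1 ^+ 2 + w.2 ^+ 2) * (distD w - s))).
    rewrite -subr_ge0 (_ : _ - _ = (c1 * re w + c2 * im w) ^+ 2) ?sqr_ge0//.
    by rewrite /distD /re /im; ring.
  rewrite -mulrA ler_wpM2l ?addr_ge0 ?sqr_ge0//.
  have Ds : 0 <= distD w - s by rewrite /distD addrK -!expr2 addr_ge0 ?sqr_ge0.
  apply: (@le_trans _ _ (1 * (distD w - s))); first by rewrite ler_wpM2r.
  by rewrite mul1r lerBlDr lerDl ltW.
apply: (@le_trans _ _ (2 * (m * (Num.sqrt (distE w))^-1))).
  apply: (le_trans (ler_normB _ _)); rewrite mulr_natl mulr2n; exact: lerD.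
rewrite mulrA ler_wpM2l ?mulr_ge0//.
set al := _ + s / 2; set be := _ + s / 2.
have s2 : 0 < s / 2 by rewrite divr_gt0.
have al0 : 0 < al by rewrite ltr_wpDl ?sqr_ge0.
have be0 : 0 < be by rewrite ltr_wpDl ?sqr_ge0.
have Eab : distE w = al + be by rewrite /distE /al /be; field.
rewrite powRN lef_pV2 ?posrE ?sqrtr_gt0 ?powR_gt0 ?mulr_gt0//.
apply: (@le_trans _ _ ((distE w ^+ 2) `^ 4^-1)).
  rewrite ge0_ler_powR ?nnegrE ?invr_ge0 ?mulr_ge0 ?(ltW al0) ?(ltW be0) ?sqr_ge0 ?(ltW e0)//.
  by rewrite Eab; nra.
rewrite -(powR_mulrn 2 (ltW e0)) -powRrM -powR12_sqrt ?(ltW e0)//.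
by rewrite (_ : 2%:R * 4^-1 = 2^-1 :> R)//; field.
Qed.

End TestFunctions.

(** * Weakly divergence-free fields tested against the regularized kernel *)

Section WeakField.
Variable R : realType.
Implicit Types (w : R * R) (f g : R * R -> R).

Local Notation mu2 := (@lebesgue2 R).
Local Notation J f := (\int[mu2]_(w in @disc R) f w).

Lemma Rintegral_disc0 f : (\int[mu2]_(w in @disc R) (f w)%:E = 0)%E -> J f = 0.
Proof. by rewrite /Rintegral => ->. Qed.

Lemma Rintegral_discD f g : continuous f -> continuous g ->
  J (fun w => f w + g w) = J f + J g.
Proof.
by move=> cf cg; rewrite RintegralD//; [exact: measurable_disc|exact: integrable_disc..].
Qed.

Lemma Rintegral_discB f g : continuous f -> continuous g ->
  J (fun w => f w - g w) = J f - J g.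
Proof.
by move=> cf cg; rewrite RintegralB//; [exact: measurable_disc|exact: integrable_disc..].
Qed.

Lemma continuous_add f g : continuous f -> continuous g ->
  continuous (fun w => f w + g w).
Proof. by move=> cf cg w; apply: cvgD; [exact: cf|exact: cg]. Qed.

Lemma continuous_sub f g : continuous f -> continuous g ->
  continuous (fun w => f w - g w).
Proof. by move=> cf cg w; apply: cvgB; [exact: cf|exact: cg]. Qed.

Lemma continuous_mul f g : continuous f -> continuous g ->
  continuous (fun w => f w * g w).
Proof. by move=> cf cg w; apply: cvgM; [exact: cf|exact: cg]. Qed.

Section Field.
Variables (V0 V1 : R * R -> R) (V0' V1' : 'I_2 -> R * R -> R).
Hypotheses (kV0 : C1 V0 V0') (kV1 : C1 V1 V1').

(* Divergence free and tangential to the circle, in weak form. *)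
Hypothesis V_weak : forall psi psi', rational_fun psi -> C1 psi psi' ->
  J (fun w => V0 w * psi' 0 w + V1 w * psi' 1 w) = 0.

Let curl w := V0' 1 w - V1' 0 w.

Lemma continuous_curl : continuous curl.
Proof. by case: kV0 kV1 => _ c0 _ [_ c1 _]; exact: continuous_sub. Qed.

(** The [psi'] terms integrate to 0 by [V_weak]. Adding [curl * chi] to the [chi'] terms gives the
    derivative of [V0 * chi] along axis 1 minus that of [V1 * chi] along axis 0, and both integrate
    to 0 because [chi] vanishes on the circle. *)
Lemma curl_pairing (psi chi : R * R -> R) (psi' chi' : 'I_2 -> R * R -> R) :
  rational_fun psi -> C1 psi psi' -> C1 chi chi' ->
  (forall w, w.1 ^+ 2 + w.2 ^+ 2 = 1 -> chi w = 0) ->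
  J (fun w => V0 w * (psi' 0 w + chi' 1 w) + V1 w * (psi' 1 w - chi' 0 w)) =
  - J (fun w => curl w * chi w).
Proof.
move=> rpsi kpsi kchi chi0.
have [cV0 cV0' _] := kV0; have [cV1 cV1' _] := kV1.
have [cchi cchi' _] := kchi; have [cpsi cpsi' _] := kpsi.
have h0 : J (fun w => V0' 1 w * chi w + V0 w * chi' 1 w) = 0.
  apply: Rintegral_disc0; apply: (integral_partial_disc 1 (C1_mul kV0 kchi)).
  by move=> w /chi0 ->; rewrite mulr0.
have h1 : J (fun w => V1' 0 w * chi w + V1 w * chi' 0 w) = 0.
  apply: Rintegral_disc0; apply: (integral_partial_disc 0 (C1_mul kV1 kchi)).
  by move=> w /chi0 ->; rewrite mulr0.
apply/eqP; rewrite -subr_eq0 opprK; apply/eqP.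
have cM := continuous_mul; have cD := continuous_add; have cB := continuous_sub.
rewrite -Rintegral_discD; last 2 first.
- by apply: (cD); apply: (cM) => //; [exact: (cD)|exact: (cB)].
- by apply: (cM) => //; exact: continuous_curl.
have := V_weak rpsi kpsi => h2.
transitivity (J (fun w => V0 w * psi' 0 w + V1 w * psi' 1 w) +
  (J (fun w => V0' 1 w * chi w + V0 w * chi' 1 w) -
   J (fun w => V1' 0 w * chi w + V1 w * chi' 0 w))); last first.
  by rewrite h0 h1 h2 subrr addr0.
rewrite -Rintegral_discB; [|by apply: (cD); apply: (cM)..].
rewrite -Rintegral_discD; last 2 first.
- by apply: (cD); apply: (cM).
- by apply: (cB); apply: (cD); apply: (cM).
by apply: eq_Rintegral => w _; rewrite /curl; ring.
Qed.

Variables (a b : R).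
Hypothesis ab1 : a ^+ 2 + b ^+ 2 < 1.

Let c1 := V0 (a, b).
Let c2 := V1 (a, b).
Let n2 := c1 ^+ 2 + c2 ^+ 2.

(** The left integrand of [curl_pairing] for the test functions with [s = h ^ 2] and [c] the value
    of the field at the pole [(a, b)]. *)
Let main h w := 2 * h ^+ 2 * (V0 w * c1 + V1 w * c2) / distE a b (h ^+ 2) w ^+ 2 -
  2 * h ^+ 2 * (V0 w * (c1 * (a * w.1 - b * w.2) + c2 * (a * w.2 + b * w.1)) +
    V1 w * (c1 * (a * w.2 + b * w.1) - c2 * (a * w.1 - b * w.2))) /
    distD a b (h ^+ 2) w ^+ 2.

Let square h : set (R * R) := `[a - h, a + h]%classic `*` `[b - h, b + h]%classic.

Let squareP h w : square h w <-> (`|w.1 - a| <= h /\ `|w.2 - b| <= h).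
Proof.
rewrite /square /= !in_itv /= !ler_norml.
by split=> -[/andP[? ?] /andP[? ?]]; split; apply/andP; split; lra.
Qed.

(** At the pole the product of the field with [c] equals [n2]; continuity keeps it above half of
    that nearby. *)
Lemma square_near : 0 < n2 -> exists2 e : R, 0 < e & square e `<=` @disc R /\
  forall w, square e w -> n2 / 2 <= V0 w * c1 + V1 w * c2.
Proof.
move=> n20; have [cV0 _ _] := kV0; have [cV1 _ _] := kV1.
have cVc : continuous (fun w => V0 w * c1 + V1 w * c2).
  by apply: continuous_add; apply: continuous_mul => // w; exact: cvg_cst.
have near1 : \forall w \near ((a, b) : R * R), n2 / 2 < V0 w * c1 + V1 w * c2.
  apply: (cvgr_gt (V0 (a, b) * c1 + V1 (a, b) * c2) (cVc (a, b))).
  rewrite -/c1 -/c2 -!expr2 -/n2 -subr_gt0.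
  by rewrite (_ : n2 - n2 / 2 = n2 / 2) ?divr_gt0//; field.
have near2 : \forall w \near ((a, b) : R * R), disc w by exact: disc_near.
have /nbhs_ballP[e /= e0 he] : \forall w \near ((a, b) : R * R),
    n2 / 2 < V0 w * c1 + V1 w * c2 /\ disc w by exact: filterI.
have sub w : square (e / 2) w -> ball ((a, b) : R * R) e w.
  move=> /squareP[h1 h2]; split; rewrite /ball /= distrC.
    by apply: (le_lt_trans h1); lra.
  by apply: (le_lt_trans h2); lra.
exists (e / 2); first by rewrite divr_gt0.
by split=> w /sub/he[h1 h2] //; exact: ltW.
Qed.

(** The real part of [1 - conj w0 * w] is half the sum of [|w0 - w|^2], [1 - |w|^2] and
    [1 - |w0|^2]. The bound does not depend on [h], so the [distD] term of [main] is of order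
    [h ^ 2]. *)
Lemma distD_ge h w : disc w ->
  ((1 - (a ^+ 2 + b ^+ 2)) / 2) ^+ 2 <= distD a b (h ^+ 2) w.
Proof.
case: w => x y; rewrite /disc /distD /= => Dw.
set k := (1 - (a ^+ 2 + b ^+ 2)) / 2.
have k0 : 0 < k by rewrite divr_gt0// subr_gt0.
have Pk : k <= 1 - (a * x + b * y).
  rewrite -subr_ge0 (_ : _ - k = ((a - x) ^+ 2 + (b - y) ^+ 2) / 2 +
    (1 - (x ^+ 2 + y ^+ 2)) / 2); last by rewrite /k; field.
  apply: addr_ge0; apply: divr_ge0 => //; first by rewrite addr_ge0 ?sqr_ge0.
  by rewrite subr_ge0 ltW.
rewrite -!expr2 -addrA; apply: (@le_trans _ _ ((1 - (a * x + b * y)) ^+ 2)).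
  by rewrite lerXn2r ?nnegrE// ?(ltW k0)// (le_trans (ltW k0)).
by rewrite lerDl addr_ge0 ?sqr_ge0.
Qed.

(* The kernel [2 h^2 / distE^2] is an approximate identity as [h] tends to 0. *)
Lemma main_lower_bound : 0 < n2 ->
  exists (e K : R), [/\ 0 < e, 0 <= K, square e `<=` @disc R &
  forall h, 0 < h <= e -> forall w, disc w ->
    0 <= main h w + K * h ^+ 2 /\
    (square h w -> n2 / (9 * h ^+ 2) <= main h w + K * h ^+ 2)].
Proof.
move=> n20; have [e e0 [eD eV]] := square_near n20.
have [cV0 _ _] := kV0; have [cV1 _ _] := kV1.
have cst c : continuous (fun _ : R * R => c : R) by move=> w; exact: cvg_cst.
have c1' := @continuous_fst R; have c2' := @continuous_snd R.
have cVc : continuous (fun w => V0 w * c1 + V1 w * c2).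
  by apply: continuous_add; exact: continuous_mul.
have cVr : continuous (fun w => V0 w * (c1 * (a * w.1 - b * w.2) + c2 * (a * w.2 + b * w.1)) +
    V1 w * (c1 * (a * w.2 + b * w.1) - c2 * (a * w.1 - b * w.2))).
  have cA : continuous (fun w => a * w.1 - b * w.2).
    by apply: continuous_sub; exact: continuous_mul.
  have cB : continuous (fun w => a * w.2 + b * w.1).
    by apply: continuous_add; exact: continuous_mul.
  apply: continuous_add; apply: continuous_mul => //.
    by apply: continuous_add; exact: continuous_mul.
  by apply: continuous_sub; exact: continuous_mul.
have [M1 M10 hM1] := continuous_bounded_cdisc cVc.
have [M2 M20 hM2] := continuous_bounded_cdisc cVr.
set k := ((1 - (a ^+ 2 + b ^+ 2)) / 2) ^+ 2.
have k0 : 0 < k by rewrite exprn_gt0// divr_gt0// subr_gt0.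
(* [K1] absorbs a possibly negative first term of [main] outside the square of half side [e], where
   [distE >= e ^ 2]; [K2] absorbs the second term, where [distD >= k] throughout the disc. *)
pose K1 := 2 * M1 / e ^+ 4; pose K2 := 2 * M2 / k ^+ 2.
have K10 : 0 <= K1 by rewrite divr_ge0 ?mulr_ge0 ?exprn_ge0// (ltW e0).
have K20 : 0 <= K2 by rewrite divr_ge0 ?sqr_ge0 ?mulr_ge0.
exists e, (K1 + K2); split; [by []|exact: addr_ge0|by []|].
move=> h /andP[h0 he] w Dw; have Dw' := disc_cdisc Dw.
have h20 : 0 < h ^+ 2 by rewrite exprn_gt0.
set E := distE a b (h ^+ 2) w; set D := distD a b (h ^+ 2) w.
have Ep : 0 < E by exact: distE_gt0.
have Dk : k <= D by exact: distD_ge.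
have Dp : 0 < D by exact: lt_le_trans Dk.
set t1 := V0 w * c1 + V1 w * c2.
pose t2 := V0 w * (c1 * (a * w.1 - b * w.2) + c2 * (a * w.2 + b * w.1)) +
    V1 w * (c1 * (a * w.2 + b * w.1) - c2 * (a * w.1 - b * w.2)).
have main2 : 2 * h ^+ 2 * t2 / D ^+ 2 <= K2 * h ^+ 2.
  rewrite ler_pdivrMr ?exprn_gt0// /K2.
  have D2 : k ^+ 2 <= D ^+ 2 by rewrite lerXn2r ?nnegrE ?(ltW k0) ?(ltW Dp).
  have t2M : t2 <= M2 by exact: le_trans (ler_norm _) (hM2 _ Dw').
  rewrite (_ : 2 * M2 / k ^+ 2 * h ^+ 2 * D ^+ 2 = 2 * h ^+ 2 * (M2 * (D ^+ 2 / k ^+ 2))); last first.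
    by field; rewrite gt_eqF.
  apply: ler_wpM2l; first by rewrite mulr_ge0// ltW.
  apply: (le_trans t2M).
  by rewrite ler_peMr// ler_pdivlMr ?mul1r// exprn_gt0.
have -> : main h w + (K1 + K2) * h ^+ 2 =
    (2 * h ^+ 2 * t1 / E ^+ 2 + K1 * h ^+ 2) +
    (K2 * h ^+ 2 - 2 * h ^+ 2 * t2 / D ^+ 2).
  by rewrite /main -/E -/D -/t1 -/t2; ring.
have g2 : 0 <= K2 * h ^+ 2 - 2 * h ^+ 2 * t2 / D ^+ 2 by rewrite subr_ge0.
have Kh : 0 <= K1 * h ^+ 2 by rewrite mulr_ge0 ?(ltW h20).
(* On the square of half side [h] one has [E <= 3 h^2], so the first term is at least
   [2 h^2 (n2 / 2) / (9 h^4)]. *)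
have sq : square h w -> n2 / (9 * h ^+ 2) <= 2 * h ^+ 2 * t1 / E ^+ 2.
  move=> /[dup] /squareP[w1 w2] sw.
  have t1n : n2 / 2 <= t1.
    by apply: eV; apply/squareP; split; exact: le_trans he.
  have E3 : E <= 3 * h ^+ 2.
    have -> : E = `|w.1 - a| ^+ 2 + `|w.2 - b| ^+ 2 + h ^+ 2.
      by rewrite !real_normK ?num_real// /E /distE -!expr2.
    have x1 := normr_ge0 (w.1 - a); have x2 := normr_ge0 (w.2 - b).
    nra.
  apply: (@le_trans _ _ (2 * h ^+ 2 * (n2 / 2) / E ^+ 2)); last first.
    by rewrite ler_pdivrMr ?exprn_gt0// mulfVK ?gt_eqF ?exprn_gt0// ler_wpM2l// mulr_ge0// ltW.
  rewrite ler_pdivlMr ?exprn_gt0//.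
  apply: (@le_trans _ _ (n2 / (9 * h ^+ 2) * (3 * h ^+ 2) ^+ 2)).
    apply: ler_wpM2l; first by rewrite ltW// divr_gt0// mulr_gt0.
    apply: lerXn2r => //; rewrite nnegrE; first exact: ltW.
    by rewrite ltW// mulr_gt0.
  by rewrite le_eqVlt; apply/orP; left; apply/eqP; field; rewrite gt_eqF.
split; last by move=> /sq; lra.
rewrite addr_ge0//.
have [ew|ew] := pselect (square e w).
  apply: addr_ge0 => //; apply: divr_ge0; last exact: sqr_ge0.
  apply: mulr_ge0; first by rewrite mulr_ge0// ltW.
  by apply: le_trans (eV _ ew); rewrite ltW// divr_gt0.
have Ee : e ^+ 2 <= E.
  rewrite leNgt; apply/negP => Ele; apply: ew; apply/squareP.
  have e1 : `|w.1 - a| ^+ 2 + `|w.2 - b| ^+ 2 < e ^+ 2.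
    rewrite !real_normK ?num_real//; apply: le_lt_trans Ele.
    by rewrite /E /distE -!expr2 lerDl ltW.
  have x1 := normr_ge0 (w.1 - a); have x2 := normr_ge0 (w.2 - b).
  by split; nra.
have t1M : - M1 <= t1 by have := hM1 _ Dw'; rewrite ler_norml => /andP[].
rewrite -lerBlDr sub0r -mulNr ler_pdivlMr ?exprn_gt0//.
have E4 : e ^+ 4 <= E ^+ 2.
  rewrite (exprM e 2 2); apply: lerXn2r => //; rewrite nnegrE.
    exact: sqr_ge0.
  exact: ltW.
rewrite (_ : - K1 * h ^+ 2 * E ^+ 2 = - (2 * h ^+ 2 * (M1 * (E ^+ 2 / e ^+ 4)))); last first.
  by rewrite /K1; field; rewrite gt_eqF.
rewrite lerNl -mulrN; apply: ler_wpM2l; first by rewrite mulr_ge0// ltW.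
apply: (@le_trans _ _ M1); first by rewrite lerNl.
by rewrite ler_peMr// ler_pdivlMr ?mul1r// exprn_gt0.
Qed.

End Field.
End WeakField.

(** * The pointwise bound of such a field by the norm of its curl *)

Section GradientBound.
Variable R : realType.
Implicit Types (w : R * R) (f g : R * R -> R).

Local Notation mu2 := (@lebesgue2 R).
Local Notation J f := (\int[mu2]_(w in @disc R) f w).

Lemma EFin_Rintegral_disc f : continuous f ->
  ((J f)%:E = \int[mu2]_(w in @disc R) (f w)%:E)%E.
Proof.
move=> cf; rewrite /Rintegral fineK//; apply: integrable_fin_num.
  exact: measurable_disc.
exact: integrable_disc.
Qed.

Lemma square_Rintegral_le f (a b h l : R) : continuous f -> 0 < h -> 0 <= l ->
  `[a - h, a + h]%classic `*` `[b - h, b + h]%classic `<=` @disc R ->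
  (forall w, disc w -> 0 <= f w) ->
  (forall w, (`[a - h, a + h]%classic `*` `[b - h, b + h]%classic) w -> l <= f w) ->
  4 * h ^+ 2 * l <= J f.
Proof.
move=> cf h0 l0 sD f0 fl; rewrite -lee_fin EFin_Rintegral_disc//.
set S := _ `*` _ in sD fl.
have mS : measurable S by apply: measurableX; exact: measurable_itv.
have mf D : measurable_fun D (EFin \o f).
  by apply: measurable_funTS; apply/measurable_EFinP; exact: continuous_measurable_plane.
apply: (@le_trans _ _ (\int[mu2]_(w in S) (f w)%:E)%E); last first.
  apply: ge0_subset_integral.
  - exact: mS.
  - exact: measurable_disc.
  - exact: mf.
  - by move=> w Dw; rewrite lee_fin; exact: f0.
  - exact: sD.
apply: (@le_trans _ _ (\int[mu2]_(w in S) l%:E)%E); last first.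
  apply: ge0_le_integral.
  - exact: mS.
  - by move=> w _; rewrite lee_fin.
  - exact: measurable_cst.
  - exact: mf.
  - by move=> w Sw; rewrite lee_fin; exact: fl.
rewrite integral_cst; last exact: mS.
rewrite -[X in (_ * X)%E]/(mu2 S) lebesgue2_itv; [|lra..].
by rewrite -EFinM lee_fin le_eqVlt; apply/orP; left; apply/eqP; ring.
Qed.

Lemma square_sub (a b h e : R) : h <= e ->
  `[a - h, a + h]%classic `*` `[b - h, b + h]%classic `<=`
  `[a - e, a + e]%classic `*` `[b - e, b + e]%classic.
Proof.
move=> he w; rewrite /= !in_itv /= => -[/andP[? ?] /andP[? ?]].
by split; apply/andP; split; lra.
Qed.

Lemma Rintegral_disc_cst (c : R) : 0 <= c -> J (fun=> c) <= c * 4.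
Proof.
move=> c0; have -> : J (fun=> c) = c * fine (mu2 (@disc R)).
  by rewrite Rintegral_cst//; exact: measurable_disc.
apply: ler_wpM2l => //; have := lebesgue2_disc R; have := lebesgue2_disc_lty R.
by case: (mu2 (@disc R)).
Qed.

(** Both sides of [curl_pairing] are estimated: the concentrating kernel bounds the left one from
    below by [4/9 |V(w)|^2] up to an error, while [chi_bound] and [pairing_bound] bound the right
    one by [2 K |V(w)|] times the norm of the curl. *)
Lemma gradient_bound (p : \bar R) : (2%:E < p)%E ->
  exists2 c : R, 0 < c & forall V0 V1 V0' V1',
    C1 V0 V0' -> C1 V1 V1' ->
    (forall psi psi', rational_fun psi -> C1 psi psi' ->
      J (fun w => V0 w * psi' 0 w + V1 w * psi' 1 w) = 0) ->
    forall w, disc w -> ((Num.sqrt (V0 w ^+ 2 + V1 w ^+ 2))%:E <=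
      c%:E * Lp_disc p (fun w => V0' 1 w - V1' 0 w)%R)%E.
Proof.
move=> p2; have [K K0 hK] := @pairing_bound R p p2.
(* The constant results from dividing [4/9 * m ^ 2 <= 2 * m * K * r] by [m]. *)
exists (9 / 2 * K); first by rewrite mulr_gt0.
move=> V0 V1 V0' V1' kV0 kV1 weak [a b] Dw.
have ab1 : a ^+ 2 + b ^+ 2 < 1 by [].
set L := Lp_disc p _; have L0 : (0 <= L)%E by exact: Lnorm_ge0.
set n2 := V0 (a, b) ^+ 2 + V1 (a, b) ^+ 2; set m := Num.sqrt n2.
have n2ge0 : 0 <= n2 by rewrite addr_ge0 ?sqr_ge0.
have [n20|] := ltP 0 n2; last first.
  move=> n20; have -> : m = 0 by rewrite /m ler0_sqrtr.
  by rewrite mule_ge0// lee_fin ltW// mulr_gt0.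
have m0 : 0 < m by rewrite sqrtr_gt0.
have m2 : m ^+ 2 = n2 by rewrite sqr_sqrtr.
case EL : L L0 => [r| |] // r0; last first.
  by rewrite gt0_muley ?leey// lte_fin mulr_gt0.
rewrite lee_fin in r0; rewrite -EFinM lee_fin.
suff main_le : 4 / 9 * n2 <= 2 * m * K * r.
  have : m * (4 / 9 * m) <= m * (2 * K * r).
    by move: main_le; rewrite -m2 expr2; congr (_ <= _); ring.
  by rewrite ler_pM2l// => h; lra.
apply/ler_addgt0Pr => eta eta0.
have [e [K' [e0 K'0 eD lower]]] := main_lower_bound kV0 kV1 ab1 n20.
(* [h <= e] makes the lower bound available, [h <= 1] gives [h ^ 2 <= h], and the last bound makes
   the error [K' h^2], integrated over a disc of measure at most 4, smaller than [eta]. *)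
pose h := Num.min e (Num.min 1 (eta / (4 * K' + 1))).
have q0 : 0 < eta / (4 * K' + 1) by rewrite divr_gt0// ltr_wpDl// mulr_ge0.
have h0 : 0 < h by rewrite /h !lt_min e0 ltr01 q0.
have he : h <= e by rewrite /h ge_min lexx.
have h1 : h <= 1 by rewrite /h !ge_min lexx orbT.
have hq : h <= eta / (4 * K' + 1) by rewrite /h !ge_min lexx !orbT.
have h20 : 0 < h ^+ 2 by rewrite exprn_gt0.
have Kh : K' * h ^+ 2 * 4 <= eta.
  rewrite ler_pdivlMr in hq; last by rewrite ltr_wpDl// mulr_ge0.
  have : h ^+ 2 <= h by rewrite expr2 ler_piMr// ltW.
  nra.
have [psi' [chi' [kpsi kchi id1 id2]]] :=
  @psi_chi_C1 R a b (V0 (a, b)) (V1 (a, b)) (h ^+ 2) h20.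
have := curl_pairing kV0 kV1 weak (@rational_psi R a b (V0 (a, b)) (V1 (a, b)) (h ^+ 2) h20)
  kpsi kchi (@chi_circle R a b (V0 (a, b)) (V1 (a, b)) (h ^+ 2)).
set F := fun w : R * R => V0 w * (psi' 0 w + chi' 1 w) + V1 w * (psi' 1 w - chi' 0 w).
set chi := test_chi _ _ _ _ _ in kchi *.
set f := fun w : R * R => V0' 1 w - V1' 0 w.
move=> JF.
have [cV0 cV0' _] := kV0; have [cV1 cV1' _] := kV1.
have [cchi cchi' _] := kchi; have [cpsi cpsi' _] := kpsi.
have cf : continuous f by exact: continuous_sub.
have cF : continuous F.
  apply: continuous_add; apply: continuous_mul => //.
    exact: continuous_add.
  exact: continuous_sub.
have ccst (c : R) : continuous (fun _ : R * R => c) by move=> w; exact: cvg_cst.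
have up : - J (fun w => f w * chi w) <= 2 * m * K * r.
  apply: (@le_trans _ _ `|J (fun w => f w * chi w)|).
    by rewrite -normrN ler_norm.
  have cfc : continuous (fun w => f w * chi w) by exact: continuous_mul.
  apply: (le_trans (le_normr_Rintegral _ (integrable_disc cfc))).
    exact: measurable_disc.
  rewrite -lee_fin EFin_Rintegral_disc; last first.
    by move=> w; apply: cvg_norm; exact: cfc.
  rewrite EFinM -EL; apply: (hK (2 * m) a b (h ^+ 2 / 2)) => //.
  - by rewrite mulr_ge0// ltW.
  - by rewrite -ler_norml -ler_sqr ?nnegrE// real_normK ?num_real// expr1n;
      have := sqr_ge0 b; lra.
  - by rewrite -ler_norml -ler_sqr ?nnegrE// real_normK ?num_real// expr1n;
      have := sqr_ge0 a; lra.
  - by rewrite divr_gt0.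
  - by nra.
  - by move=> w Dw'; apply: chi_bound.
have low : 4 / 9 * n2 <= J (fun w => F w + K' * h ^+ 2).
  (* The square of half side [h] has area [4 h^2], and the integrand there is at least
     [n2 / (9 h^2)]. *)
  have -> : 4 / 9 * n2 = 4 * h ^+ 2 * (n2 / (9 * h ^+ 2)).
    by field; rewrite gt_eqF.
  have sub := @square_sub a b h e he.
  have FE w : F w = 2 * h ^+ 2 * (V0 w * V0 (a, b) + V1 w * V1 (a, b)) / distE a b (h ^+ 2) w ^+ 2 -
    2 * h ^+ 2 * (V0 w * (V0 (a, b) * (a * w.1 - b * w.2) + V1 (a, b) * (a * w.2 + b * w.1)) +
    V1 w * (V0 (a, b) * (a * w.2 + b * w.1) - V1 (a, b) * (a * w.1 - b * w.2))) /
    distD a b (h ^+ 2) w ^+ 2.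
    by rewrite /F id1 id2; ring.
  have hhe : 0 < h <= e by apply/andP.
  apply: (@square_Rintegral_le _ a b) => //.
  - by apply: continuous_add.
  - by rewrite ltW// divr_gt0// mulr_gt0.
  - by move=> w /sub; exact: eD.
  - by move=> w Dw'; rewrite FE; have [] := lower h hhe w Dw'.
  - by move=> w sw; rewrite FE; have [_] := lower h hhe w (eD _ (sub _ sw)); exact.
rewrite Rintegral_discD// in low.
apply: (le_trans low); rewrite JF; apply: lerD => //.
by apply: le_trans Kh; apply: Rintegral_disc_cst; rewrite mulr_ge0// ltW.
Qed.

End GradientBound.

(** * Torsion of a normal frame, its change under rotation, and the Coulomb condition *)

Section Torsion.
Variable R : realType.
Implicit Types (w : R * R) (X Y : R * R -> 'rV[R]_4).

Local Notation mu2 := (@lebesgue2 R).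
Local Notation J f := (\int[mu2]_(w in @disc R) f w).

Lemma dot_eq0 (x : 'rV[R]_4) : dot x x = 0 -> x = 0.
Proof.
move=> /eqP; rewrite /dot psumr_eq0 => [/allP x0|j _]; last by rewrite -expr2 sqr_ge0.
apply/rowP => j; rewrite mxE; apply/eqP.
by have := x0 j (mem_index_enum j); rewrite -expr2 sqrf_eq0.
Qed.

(** Where [W] vanishes, conformality makes both tangent vectors vanish, against rank 2. *)
Lemma area_elt_neq0 k b X w : immersion k b X -> conformal X -> disc w ->
  area_elt X w != 0.
Proof.
move=> [_ rk] cX /disc_cdisc Dw; apply/eqP => a0.
have [e _] := cX w Dw.
have v0 : vpd 0 X w = 0 by exact: dot_eq0.
have v1 : vpd 1 X w = 0 by apply: dot_eq0; rewrite -e.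
have M0 : \matrix_(i < 2) vpd i X w = 0.
  apply/row_matrixP => i; rewrite rowK row0.
  by case: i => [[|[|//]] hi]; [rewrite -[RHS]v0|rewrite -[RHS]v1]; congr vpd; exact: val_inj.
by have := rk w Dw; rewrite M0 mxrank0.
Qed.

(** The rule [T + d phi] for a rotated frame, at one point: [x0], [x1] are the frame vectors, [g0],
    [g1] their partial derivatives, [C], [S] the cosine and sine of the angle, [q] its partial
    derivative. After expansion only the orthonormality relations and their derivatives enter. *)
Lemma rotated_torsion_algebra (x0 x1 g0 g1 : 'I_4 -> R) (C S q : R) :
  C ^+ 2 + S ^+ 2 = 1 ->
  \sum_j x0 j * x0 j = 1 -> \sum_j x1 j * x1 j = 1 -> \sum_j x0 j * x1 j = 0 ->
  \sum_j g0 j * x0 j = 0 -> \sum_j g1 j * x1 j = 0 ->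
  \sum_j g1 j * x0 j = - \sum_j g0 j * x1 j ->
  \sum_j (((- S * q) * x0 j + C * g0 j) + ((C * q) * x1 j + S * g1 j)) *
    (- S * x0 j + C * x1 j) = \sum_j g0 j * x1 j + q.
Proof.
move=> CS h00 h11 h01 e00 e11 e10.
transitivity (S ^+ 2 * q * (\sum_j x0 j * x0 j) - 2 * S * C * q * (\sum_j x0 j * x1 j)
   - C * S * (\sum_j g0 j * x0 j) + C ^+ 2 * (\sum_j g0 j * x1 j)
   + C ^+ 2 * q * (\sum_j x1 j * x1 j) - S ^+ 2 * (\sum_j g1 j * x0 j)
   + S * C * (\sum_j g1 j * x1 j)).
  by rewrite !big_ord_recr !big_ord0 /=; ring.
rewrite h00 h11 h01 e00 e11 e10.
have -> : S ^+ 2 = 1 - C ^+ 2 by rewrite -CS addrC addKr.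
ring.
Qed.

Section Frame.
Variables (k : nat) (b : R) (X : R * R -> 'rV[R]_4) (N : 'I_2 -> R * R -> 'rV[R]_4).
Hypotheses (k3 : (3 <= k)%N) (b0 : 0 < b) (frameN : normal_frame k b X N).

(** [3 <= k] leaves the frame two derivatives: the torsion takes one, and its curl the second. *)
Lemma frame_ext : exists (F : 'I_2 -> 'I_4 -> R * R -> R)
    (G : 'I_2 -> 'I_4 -> 'I_2 -> R * R -> R)
    (H : 'I_2 -> 'I_4 -> 'I_2 -> 'I_2 -> R * R -> R),
  [/\ forall s j, C1 (F s j) (G s j), forall s j i, C1 (G s j i) (H s j i) &
    forall s j w, disc w -> F s j w = N s w 0 j].
Proof.
have [regN _] := frameN.
have h (sj : 'I_2 * 'I_4) : exists FGH : (R * R -> R) * ('I_2 -> R * R -> R) *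
      ('I_2 -> 'I_2 -> R * R -> R),
    [/\ C1 FGH.1.1 FGH.1.2, forall i, C1 (FGH.1.2 i) (FGH.2 i) &
      forall w, disc w -> FGH.1.1 w = N sj.1 w 0 sj.2].
  have k2 : (2 <= k.-1)%N by case: k k3 => [|[]].
  have [F [G [H ?]]] := Ckb_ext k2 b0 (regN sj.1 sj.2).
  by exists (F, G, H).
have [FGH hFGH] := choice h.
exists (fun s j => (FGH (s, j)).1.1), (fun s j => (FGH (s, j)).1.2),
  (fun s j => (FGH (s, j)).2).
by split=> [s j|s j i|s j w Dw]; have [h1 h2 h3] := hFGH (s, j);
  [exact: h1|exact: h2|exact: h3].
Qed.

Variables (F : 'I_2 -> 'I_4 -> R * R -> R) (G : 'I_2 -> 'I_4 -> 'I_2 -> R * R -> R)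
  (H : 'I_2 -> 'I_4 -> 'I_2 -> 'I_2 -> R * R -> R).
Hypotheses (kF : forall s j, C1 (F s j) (G s j))
  (kG : forall s j i, C1 (G s j i) (H s j i))
  (FN : forall s j w, disc w -> F s j w = N s w 0 j).

(** [T i] extends the torsion coefficient of index [i] continuously from the disc to the plane, and
    [T' i l] represents its derivative along axis [l]. *)
Let T i w := \sum_j G 0 j i w * F 1 j w.
Let T' i l w := \sum_j (H 0 j i l w * F 1 j w + G 0 j i w * G 1 j l w).

Lemma torsion_C1 i : C1 (T i) (T' i).
Proof. by apply: C1_sum => j; exact: C1_mul. Qed.

Lemma dot_frame s t w : disc w -> \sum_j F s j w * F t j w = (s == t)%:R.
Proof.
move=> Dw; have [_ /(_ w (disc_cdisc Dw))[<- _ _]] := frameN.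
by apply: eq_bigr => j _; rewrite !FN.
Qed.

(** Differentiating the constant inner products of the frame gives the skew symmetry; for [s = t]
    the sum is its own negative. *)
Lemma dot_frame_deriv s t i w : disc w ->
  \sum_j G s j i w * F t j w = - \sum_j G t j i w * F s j w.
Proof.
move=> Dw; apply/eqP; rewrite -addr_eq0 -big_split; apply/eqP.
have [_ _ /(_ w i Dw) h1] := C1_sum (index_enum 'I_4) (fun j => C1_mul (kF s j) (kF t j)).
have h2 : is_derive w (axis R i) (fun z => \sum_(j < 4) F s j z * F t j z) 0.
  apply: (@is_derive_disc _ (fun=> (s == t)%:R)) => //.
  by move=> z Dz; rewrite dot_frame.
have [_ d1] := h1; have [_ d2] := h2; rewrite d1 in d2; rewrite -[RHS]d2.
by apply: eq_bigr => j _ /=; congr (_ + _); rewrite mulrC.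
Qed.

Lemma vpd_row (Y : R * R -> 'rV[R]_4) (g : 'I_4 -> R * R -> R) i w : disc w ->
  (forall j, continuous (g j)) ->
  (forall j z, disc z -> is_derive z (axis R i) (fun z => Y z 0 j) (g j z)) ->
  vpd i Y w = \row_j g j w.
Proof. by move=> Dw cg h; apply/rowP => j; rewrite !mxE; exact: pdE. Qed.

Lemma torsionE i w : disc w -> torsion N 0 i 1 w = T i w.
Proof.
move=> Dw; have vN : vpd i (N 0) w = \row_j G 0 j i w.
  apply: (@vpd_row _ (fun j => G 0 j i)) => // [j|j z Dz].
    by have [_] := kF 0 j.
  apply: (@is_derive_disc _ (F 0 j)) => // [y Dy|]; first exact: FN.
  by have [_ _ h] := kF 0 j; exact: h.
by rewrite /torsion vN /dot; apply: eq_bigr => j _; rewrite mxE FN.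
Qed.

Lemma curvature_areaE w : disc w -> area_elt X w != 0 ->
  curvature X N w * area_elt X w = T' 0 1 w - T' 1 0 w.
Proof.
move=> Dw a0; rewrite /curvature mulrAC mulVf// mul1r.
have pdT i l : pd l (torsion N 0 i 1) w = T' i l w.
  have [_ cT' dT'] := torsion_C1 i; apply: pdE => // z Dz.
  apply: (@is_derive_disc _ (T i)) => //; last exact: dT'.
  by move=> y Dy; rewrite torsionE.
by rewrite !pdT.
Qed.

Lemma rotate_torsionE (psi : R * R -> R) psi' e i w : C1 psi psi' -> disc w ->
  torsion (rotate N (fun w => e * psi w)) 0 i 1 w = T i w + e * psi' i w.
Proof.
move=> kpsi Dw.
have ke := C1_mul (C1_cst e) kpsi.
have ephi z : disc z -> is_derive z (axis R i) (fun w => e * psi w) (e * psi' i z).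
  move=> Dz; have [_ _ /(_ z i Dz) h] := ke.
  by move: h; rewrite mul0r add0r.
pose cs w := cos (e * psi w); pose sn w := sin (e * psi w).
have dcs z : disc z -> is_derive z (axis R i) cs (- sn z * (e * psi' i z)).
  by move=> /ephi h; apply: (is_derive_comp1 h); exact: is_derive_cos.
have dsn z : disc z -> is_derive z (axis R i) sn (cs z * (e * psi' i z)).
  by move=> /ephi h; apply: (is_derive_comp1 h); exact: is_derive_sin.
have [cpsi cpsi' _] := kpsi.
have cep : continuous (fun w => e * psi w) by have [] := ke.
have ccs : continuous cs.
  by move=> z; apply: (@continuous_comp _ _ _ (fun w => e * psi w) cos);
    [exact: cep|exact: continuous_cos].
have csn : continuous sn.
  by move=> z; apply: (@continuous_comp _ _ _ (fun w => e * psi w) sin);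
    [exact: cep|exact: continuous_sin].
pose g j z := ((- sn z * (e * psi' i z)) * F 0 j z + cs z * G 0 j i z) +
  ((cs z * (e * psi' i z)) * F 1 j z + sn z * G 1 j i z).
have vN : vpd i (rotate N (fun w => e * psi w) 0) w = \row_j g j w.
  apply: vpd_row => // [j|j z Dz].
    have [cF0 cG0 _] := kF 0 j; have [cF1 cG1 _] := kF 1 j.
    have cc : continuous (fun _ : R * R => e) by move=> z; exact: cvg_cst.
    have cns : continuous (fun z => - sn z) by move=> z; apply: cvgN; exact: csn.
    have cp := continuous_mul cc (cpsi' i).
    apply: continuous_add; apply: continuous_add; apply: continuous_mul => //;
      exact: continuous_mul.
  apply: (@is_derive_disc _ (fun y => cs y * F 0 j y + sn y * F 1 j y)) => //.
    by move=> y Dy; rewrite /rotate /= !mxE !FN.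
  have [_ _ h0] := kF 0 j; have [_ _ h1] := kF 1 j.
  exact: is_deriveDf (is_deriveMf (dcs z Dz) (h0 z i Dz))
    (is_deriveMf (dsn z Dz) (h1 z i Dz)).
rewrite /torsion vN -(@rotated_torsion_algebra (fun j => F 0 j w)
  (fun j => F 1 j w) (fun j => G 0 j i w) (fun j => G 1 j i w) (cs w) (sn w)).
- by rewrite /dot /rotate /=; apply: eq_bigr => j _; rewrite !mxE /g !FN.
- exact: cos2Dsin2.
- by rewrite dot_frame.
- by rewrite dot_frame.
- by rewrite dot_frame.
- have := dot_frame_deriv 0 0 i Dw; lra.
- have := dot_frame_deriv 1 1 i Dw; lra.
- exact: dot_frame_deriv.
Qed.

(** Since rotation by [e * psi] adds [e * psi'] to the torsion, the total torsion is a quadratic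
    polynomial in [e], whose linear coefficient is 4 times the integral in question. No
    differentiation under the integral is involved. *)
Lemma coulomb_weak (psi : R * R -> R) psi' : rational_fun psi -> C1 psi psi' ->
  is_derive (0 : R) (1 : R)
    (fun e : R => total_torsion (rotate N (fun w => e * psi w))) (0 : R) ->
  J (fun w => T 0 w * psi' 0 w + T 1 w * psi' 1 w) = 0.
Proof.
move=> rpsi kpsi; set B := J _.
have [cpsi cpsi' _] := kpsi.
have [[cT0 _ _] [cT1 _ _]] := (torsion_C1 0, torsion_C1 1).
have cM := @continuous_mul R; have cD := @continuous_add R.
pose u w := T 0 w * T 0 w + T 1 w * T 1 w.
pose v w := T 0 w * psi' 0 w + T 1 w * psi' 1 w.
pose q w := psi' 0 w * psi' 0 w + psi' 1 w * psi' 1 w.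
have cu : continuous u by apply: (cD); exact: (cM).
have cv : continuous v by apply: (cD); exact: (cM).
have cq : continuous q by apply: (cD); exact: (cM).
pose A := J u; pose D := J q.
have JZ (c : R) (f : R * R -> R) : continuous f -> J (fun w => c * f w) = c * J f.
  by move=> cf; rewrite RintegralZl//; [exact: measurable_disc|exact: integrable_disc].
have cZ (c : R) (f : R * R -> R) : continuous f -> continuous (fun w => c * f w).
  by move=> cf; apply: (cM) => // w; exact: cvg_cst.
have -> : (fun e : R => total_torsion (rotate N (fun w => e * psi w))) =
    (fun e : R => 2 * A + (4 * B * e + 2 * D * (e * e))).
  apply/funext => e; rewrite /total_torsion.
  set S := (X in _ * X); suff -> : S = J u + (2 * e * J v + e ^+ 2 * J q).
    by rewrite /B /A /D -/v; ring.
  rewrite -!JZ// -!Rintegral_discD//; last first;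
    do ?[exact: (cZ)|by apply: (cD); exact: (cZ)].
  apply: eq_Rintegral => w; rewrite inE => Dw.
  by rewrite !(rotate_torsionE e _ kpsi Dw) /u /v /q; ring.
have d1 : is_derive (0 : R) (1 : R) (fun e : R => 2 * A + (4 * B * e + 2 * D * (e * e))) (4 * B).
  have hid := is_derive_id (0 : R) (1 : R).
  have hc c := is_derive_cst (c : R) (0 : R) (1 : R).
  have := is_deriveDf (hc (2 * A)) (is_deriveDf (is_deriveMf (hc (4 * B)) hid)
    (is_deriveMf (hc (2 * D)) (is_deriveMf hid hid))).
  by move=> hd; apply: (is_derive_eq hd); rewrite /=; ring.
case: d1 => _ d1 [_ d0]; move: d1; rewrite d0 => /eqP.
by rewrite eq_sym mulf_eq0 pnatr_eq0 /= => /eqP.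
Qed.

End Frame.
End Torsion.

(** * The estimate for the complex torsion of a Coulomb frame *)

Theorem theorem5 (R : realType) (p : \bar R) (hp : (2%:E < p)%E) :
  exists2 c : R, 0 < c &
    forall (k : nat) (b : R) (X : R * R -> 'rV[R]_4)
           (N : 'I_2 -> R * R -> 'rV[R]_4),
      (3 <= k)%N -> 0 < b < 1 ->
      immersion k b X -> conformal X -> coulomb_frame k b X N ->
      forall w : R * R, disc w ->
        ((ComplexField.Normc.normc (complex_torsion N w))%:E
          <= c%:E * Lp_disc p (fun z => curvature X N z * area_elt X z)%R)%E.
Proof.
have [c c0 hc] := gradient_bound hp.
exists c => // k b X N k3 /andP[b0 _] immX confX [frameN critN] w Dw.
have [F [G [H [kF kG FN]]]] := frame_ext k3 b0 frameN.
have kT := torsion_C1 kF kG.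
have := hc _ _ _ _ (kT 0) (kT 1) _ w Dw.
rewrite -!(torsionE kF FN)// => h.
have -> : ComplexField.Normc.normc (complex_torsion N w) =
    Num.sqrt (torsion N 0 0 1 w ^+ 2 + torsion N 0 1 1 w ^+ 2).
  by rewrite /= sqrrN.
(* The norm sees values in the disc only, where [S_N W] is the curl of the extended torsion. *)
have -> : Lp_disc p (fun z => curvature X N z * area_elt X z)%R =
    Lp_disc p (fun z => \sum_j (H 0 j 0 1 z * F 1 j z + G 0 j 0 z * G 1 j 1 z) -
      \sum_j (H 0 j 1 0 z * F 1 j z + G 0 j 1 z * G 1 j 0 z)).
  rewrite /Lp_disc; congr Lnorm; congr (_ \o _); apply/funext => z.
  rewrite !patchE; case: ifPn => //; rewrite inE => Dz.
  by rewrite (curvature_areaE kF kG FN)//; exact: area_elt_neq0 immX confX Dz.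
apply: h => psi psi' rpsi kpsi.
apply: (coulomb_weak frameN kF kG FN rpsi kpsi).
exact/critN/rational_Csmooth.
Qed.
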